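(* Let $r>0$, $\sigma>0$, $V=\mathbb{R}$ and $M(v)=\frac1{\sigma\sqrt{2\pi}}\exp\left(-\frac{v^2}{2\sigma^2}\right)$ for $v\in\mathbb{R}$. Let $g^0\in L^\infty(\mathbb{R}\times V)$ be such that $0\le g^0(x,v)\le M(v)$ for all $(x,v)\in\mathbb{R}\times V$, and let $g$ be the solution of the Cauchy problem $$\partial_tg+v\partial_xg=\big(M(v)\rho_g-g\big)+r\rho_g\big(M(v)-g\big)\ \text{ on }\mathbb{R}_+\times\mathbb{R}\times V,\qquad g(0,x,v)=g^0(x,v).$$ The following two independent statements hold. 1. Assume that there exist $1\le b\le a$ such that $$(\forall(x,v)\in\mathbb{R}\times V)\quad g^0(x,v)\le\frac1bM\left(\frac xb\right)M(v)\,e^{ra}.$$ Then for all $\varepsilon>0$, $$\lim_{t\to+\infty}\left(\sup_{|x|\ge(1+\varepsilon)\sigma\sqrt{2r}\,t^{3/2}}\rho_g(t,x)\right)=0.$$ 2. Assume that there exist $\gamma\in(0,1)$ and $x_L\in\mathbb{R}$ such that $$(\forall(x,v)\in\mathbb{R}\times V)\quad g^0(x,v)\ge\gamma M(v)\mathbf{1}_{x<x_L}.$$ Then for all $\varepsilon>0$, $$\liminf_{t\to+\infty}\left(\inf_{x\le(1-\varepsilon)\sigma\left(\frac r{r+2}t\right)^{3/2}}\rho_g(t,x)\right)\ge1-\gamma.$$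
   Context: $\rho_g(t,x)=\int_Vg(t,x,v)\,dv$. The solution $g$ is the unique solution in the sense of distributions with $0\le g\le M$, identified with its mild form: for all $(t,x,v)$, $g(t,x,v)=g^0(x-vt,v)e^{-\int_0^ta(s)ds}+\int_0^te^{-\int_s^ta(\tau)d\tau}(1+r)M(v)\rho_g(s,x-v(t-s))\,ds$, where $a(\tau)=1+r\rho_g(\tau,x-(t-\tau)v)$. *)

(* Defs.v *)
From mathcomp Require Export all_boot all_order all_algebra.
From mathcomp Require Export all_classical all_reals all_analysis.
Export Order.TTheory GRing.Theory Num.Theory.
Export numFieldNormedType.Exports.

Set Implicit Arguments.
Unset Strict Implicit.
Unset Printing Implicit Defensive.

Local Open Scope classical_set_scope.
Local Open Scope ring_scope.

Definition maxwellian (R : realType) (sigma v : R) : R :=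
  (sigma * Num.sqrt (2 * pi))^-1 * expR (- (v ^+ 2 / (2 * sigma ^+ 2))).

Definition rho (R : realType) (g : R -> R -> R -> R) (t x : R) : R :=
  \int[lebesgue_measure]_(v in [set: R]) g t x v.

(* The function a(tau) of the mild formulation: the absorption rate along the
   characteristic of velocity v that passes through x at time t. *)
Definition absorption (R : realType) (r : R) (g : R -> R -> R -> R)
    (t x v tau : R) : R :=
  1 + r * rho g tau (x - (t - tau) * v).

(* Solutions of
     d_t g + v d_x g = (M(v) rho_g - g) + r rho_g (M(v) - g),  g(0, ., .) = g0,
   in mild (Duhamel) form.  The right-hand side of the equation is
   (1 + r) M(v) rho_g - (1 + r rho_g) g; the equation is integrated along the
   characteristics.  The identity is required at every point, which selects
   one representative of the L^oo class of g, so that rho g t x is meaningful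
   for every t >= 0 and x.  Only the values of g at t >= 0 matter. *)
Record mild_solution (R : realType) (r sigma : R) (g0 : R -> R -> R)
    (g : R -> R -> R -> R) : Prop := MildSolution {
  mild_measurable :
    measurable_fun [set p : R * (R * R) | 0 <= p.1]
      (fun p : R * (R * R) => g p.1 p.2.1 p.2.2) ;
  mild_bounds : forall t x v : R, 0 <= t ->
    0 <= g t x v <= maxwellian sigma v ;
  mild_formula : forall t x v : R, 0 <= t ->
    g t x v =
      g0 (x - v * t) v
        * expR (- \int[lebesgue_measure]_(s in `[0, t]) absorption r g t x v s)
      + \int[lebesgue_measure]_(s in `[0, t])
          (expR (- \int[lebesgue_measure]_(tau in `[s, t])
                     absorption r g t x v tau)
           * ((1 + r) * maxwellian sigma v * rho g s (x - v * (t - s))))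
}.

(* Main.v *)
Require Import Defs.
From mathcomp Require Import all_boot all_order all_algebra.
From mathcomp Require Import all_classical all_reals all_analysis.
From mathcomp Require Import measurable_realfun ring lra.

(**
Both statements follow from the Duhamel formula along characteristics, on which
the absorption rate 1 + r rho lies between 1 and 1 + r because 0 <= rho <= 1.

Upper bound.  Discarding the term r rho g of the absorption leaves the linear
equation of a velocity-jump process whose mass grows at rate r.  Write
  phi_w(x) = exp (- x^2 / (2 sigma^2 w^2)).
A free flight of duration tau with Maxwellian velocity turns phi_w into a
function below phi_(w + tau) (gaussian_profile_convolution): the variances
w^2 and tau^2 add up, and w^2 + tau^2 <= (w + tau)^2.  This inequality is
stable under concatenation of flights, so C e^(r t) phi_(b + t) is a
supersolution of the integral equation for rho.  The comparison with rho is
obtained by iteration: the bound C e^(r t) phi_(b + t) + theta e^((1 + 2 r) t)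
is improved to the same expression with theta / 2 (majorant_contraction), and
rho <= 1 starts the iteration.  Hence rho(t, x) <= C e^(r t) phi_(b + t)(x)
(density_gaussian_bound), which tends to 0 exponentially fast where
|x| >= (1 + eps) sigma sqrt (2 r) t^(3/2), since there
x^2 / (2 sigma^2 (b + t)^2) is at least (1 + kappa) r t for large t.

Lower bound.  The reaction is monotone in (rho, g) as long as g <= M, and this
is used through one explicit inequality over a short time step
(solution_gain_step): if g >= z M at the start of the step and rho >= c on the
way, then g at the end is at least the value that an explicit Euler step gives
to z, up to corrections of second order in the length of the step.
- With c = 0, g decreases along a characteristic at most like
  e^(- (1 + eta) t), even where rho is large (solution_flight).
- Suppose g >= z M for |v| <= W on a half-line x < X.  Backward
  characteristics with |v| <= W stay in the half-line if its end recedes at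
  speed W.  On this receding half-line the value z grows exponentially, at any given
  rate below r (1 - K), until it reaches K; W must be large enough for [-W, W] to
  carry almost all the mass of M (solution_growth).
The mass is then propagated in one flight followed by local growth.  Put
q = r / (r + 2).  Particles of velocity about sigma sqrt (q t) that fly during
the time q t carry a fraction of order exp (- q t - q t / 2) of the initial
mass to distance sigma (q t)^(3/2).  The remaining time (1 - q) t allows a
growth by exp (r (1 - q) t) = exp (2 q t), which wins over the cost
exp (3/2 q t); meanwhile the end of the half-line recedes only by O(t), which
is negligible with respect to t^(3/2).  A last growth phase of bounded length
raises rho above 1 - gamma (density_invasion).
*)

Local Open Scope classical_set_scope.
Local Open Scope ring_scope.

(** * Integrals over segments of positive times *)

Section Segments.
Context {R : realType}.
Local Notation mu := (@lebesgue_measure R).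
Local Notation positive_times := [set t : R | 0 <= t].

Lemma measurable_positive_times : measurable positive_times.
Proof.
rewrite (_ : positive_times = `[0, +oo[%classic); first exact: measurable_itv.
by apply/seteqP; split => t /=; rewrite in_itv/= andbT.
Qed.

Lemma segment_positive (s t : R) : 0 <= s -> `[s, t] `<=` positive_times.
Proof. by move=> s0 u /=; rewrite in_itv/= => /andP[su _]; apply: le_trans su. Qed.

Lemma measurable_on_segment (h : R -> R) (s t : R) :
  measurable_fun positive_times h -> 0 <= s -> measurable_fun `[s, t] h.
Proof.
move=> mh s0; apply: measurable_funS mh; first exact: measurable_positive_times.
exact: segment_positive.
Qed.

Lemma lebesgue_measure_segment (s t : R) : s <= t -> mu `[s, t] = (t - s)%:E.
Proof.
rewrite lebesgue_measure_itv/= lte_fin le_eqVlt => /orP[/eqP->|->].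
  by rewrite ltxx subrr.
by rewrite -EFinB.
Qed.

Lemma bounded_integrable_segment (h : R -> R) (C s t : R) :
  measurable_fun `[s, t] h -> (forall u, s <= u <= t -> `|h u| <= C) ->
  mu.-integrable `[s, t] (EFin \o h).
Proof.
move=> mh hC; apply: measurable_bounded_integrable => //=.
  by rewrite lebesgue_measure_itv/=; case: ifP; rewrite -?EFinB ltry.
exists C; split; first exact: num_real.
move=> x Cx y /=; rewrite in_itv/= => /hC /le_trans; apply; exact: ltW.
Qed.

Lemma Rintegral_segment_split (h : R -> R) (s u t : R) : s <= u -> u <= t ->
  mu.-integrable `[s, t] (EFin \o h) ->
  \int[mu]_(x in `[s, t]) h x =
    \int[mu]_(x in `[s, u]) h x + \int[mu]_(x in `[u, t]) h x.
Proof.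
move=> su ut ih.
have := @Rintegral_itvB R h (BLeft s) (BRight t) u ih.
rewrite !bnd_simp => /(_ su ut) E.
rewrite -(@Rintegral_itv_obnd_cbnd _ u); first by rewrite -E addrC subrK.
by apply: integrableS ih => //; apply: subset_itvScc; rewrite bnd_simp.
Qed.

Lemma Rintegral_segment_cst (c s t : R) : s <= t ->
  \int[mu]_(x in `[s, t]) c = c * (t - s).
Proof. by move=> st; rewrite Rintegral_cst//= lebesgue_measure_segment. Qed.

End Segments.

(** * The Duhamel formula for a scalar linear equation *)

Section Duhamel.
Context {R : realType} (a f : R -> R) (A B y0 : R).
Local Notation mu := (@lebesgue_measure R).
Local Notation positive_times := [set t : R | 0 <= t].
Hypothesis a_meas : measurable_fun positive_times a.
Hypothesis f_meas : measurable_fun positive_times f.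
Hypothesis a_bounds : forall t, 0 <= t -> 0 <= a t <= A.
Hypothesis f_bounds : forall t, 0 <= t -> 0 <= f t <= B.

Lemma absorption_integrable (s t : R) : 0 <= s -> mu.-integrable `[s, t] (EFin \o a).
Proof.
move=> s0; apply: (bounded_integrable_segment _ A).
  exact: measurable_on_segment.
move=> u /andP[su _]; have /andP[a0 aA] := a_bounds _ (le_trans s0 su).
by rewrite ger0_norm.
Qed.

Lemma source_integrable (s t : R) : 0 <= s -> mu.-integrable `[s, t] (EFin \o f).
Proof.
move=> s0; apply: (bounded_integrable_segment _ B).
  exact: measurable_on_segment.
move=> u /andP[su _]; have /andP[a0 aA] := f_bounds _ (le_trans s0 su).
by rewrite ger0_norm.
Qed.

Local Notation depth s t := (\int[mu]_(u in `[s, t]) a u).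

Lemma depth_split (s u t : R) : 0 <= s -> s <= u -> u <= t ->
  depth s t = depth s u + depth u t.
Proof.
by move=> s0 su ut; apply: Rintegral_segment_split => //; exact: absorption_integrable.
Qed.

Lemma depth_ge0 (s t : R) : 0 <= s -> 0 <= depth s t.
Proof.
move=> s0; apply: Rintegral_ge0 => u us.
by have /andP[] := a_bounds _ (segment_positive _ _ s0 _ us).
Qed.

Lemma depth_le (c s t : R) : 0 <= s -> s <= t -> (forall u, 0 <= u -> a u <= c) ->
  depth s t <= c * (t - s).
Proof.
move=> s0 st ac; rewrite -Rintegral_segment_cst//.
apply: le_Rintegral => //=; first exact: absorption_integrable.
  by apply: (bounded_integrable_segment _ `|c|) => //.
by move=> u us; apply/ac/(segment_positive _ _ s0 _ us).
Qed.

Lemma depth_ge (c s t : R) : 0 <= s -> s <= t -> (forall u, 0 <= u -> c <= a u) ->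
  c * (t - s) <= depth s t.
Proof.
move=> s0 st ac; rewrite -Rintegral_segment_cst//.
apply: le_Rintegral => //=; last 2 first.
- exact: absorption_integrable.
- by move=> u us; apply/ac/(segment_positive _ _ s0 _ us).
by apply: (bounded_integrable_segment _ `|c|) => //.
Qed.

(** The attenuation is continuous in its lower end point, because the depth is
    the difference of two integrals starting from 0; [a] itself is only
    measurable. *)
Lemma attenuation_measurable (t : R) :
  measurable_fun `[0, t] (fun s => expR (- depth s t)).
Proof.
have [t0|t0] := Order.TotalTheory.ltP t 0.
  by rewrite set_itv_ge ?bnd_simp -?ltNge//; exact: measurable_fun_set0.
apply: (eq_measurable_fun (fun s : R => expR (depth 0 s - depth 0 t) : R)).
  move=> s; rewrite inE/= in_itv/= => /andP[s0 st].
  by rewrite (depth_split 0 s t)// opprD addNKr.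
apply: measurableT_comp => //; apply: measurable_funB => //.
apply: subspace_continuous_measurable_fun => //.
apply: parameterized_integral_continuous => //.
exact: absorption_integrable.
Qed.

Lemma attenuated_source_integrable (s t : R) : 0 <= s ->
  mu.-integrable `[s, t] (EFin \o (fun u => expR (- depth u t) * f u)).
Proof.
move=> s0; apply: (bounded_integrable_segment _ B).
  apply: measurable_funM.
    apply: measurable_funS (attenuation_measurable t) => //.
    by apply: subset_itvScc; rewrite bnd_simp.
  exact: measurable_on_segment.
move=> u /andP[su _]; have u0 := le_trans s0 su; have /andP[f0 fB] := f_bounds _ u0.
rewrite ger0_norm ?mulr_ge0 ?expR_ge0//; apply: le_trans fB.
by rewrite ler_piMl// -[leRHS]expR0 ler_expR oppr_le0 depth_ge0.
Qed.

(** The solution of y' = f - a y, y 0 = y0.  Since [a] and [f] are merely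
    measurable, the integral formula replaces the differential equation
    throughout. *)
Definition duhamel (t : R) : R :=
  y0 * expR (- depth 0 t) + \int[mu]_(s in `[0, t]) (expR (- depth s t) * f s).

(** The formula may be restarted at any time [s], because attenuations multiply
    when depths add up. *)
Lemma duhamel_restart (s t : R) : 0 <= s -> s <= t ->
  duhamel t = duhamel s * expR (- depth s t)
    + \int[mu]_(u in `[s, t]) (expR (- depth u t) * f u).
Proof.
move=> s0 st; rewrite /duhamel.
rewrite (Rintegral_segment_split (fun u => expR (- depth u t) * f u) 0 s t)//;
  last exact: attenuated_source_integrable.
rewrite [LHS]addrA; congr (_ + _).
rewrite (depth_split 0 s t)// opprD expRD mulrA mulrDl.
apply: (congr1 (fun z => _ + z)).
rewrite -RintegralZr//; last exact: attenuated_source_integrable.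
apply: eq_Rintegral => u; rewrite inE/= in_itv/= => /andP[u0 us].
by rewrite (depth_split u s t)// opprD expRD mulrAC.
Qed.

(** First-order form over a short time step: both attenuation factors are
    bounded below by exp (- z) >= 1 - z.  The exact depth is kept in front of
    [duhamel s], because for the kinetic equation it will be compensated by the
    source, which is driven by the same density. *)
Lemma duhamel_step (s t : R) : 0 <= s -> s <= t -> 0 <= duhamel s ->
  duhamel s * (1 - depth s t)
    + (1 - A * (t - s)) * \int[mu]_(u in `[s, t]) f u <= duhamel t.
Proof.
move=> s0 st y_ge0; rewrite (duhamel_restart _ _ s0 st); apply: lerD.
  by rewrite ler_wpM2l// expR_ge1Dx.
rewrite -RintegralZl//; last exact: source_integrable.
apply: le_Rintegral => //=.
- under [X in integrable _ _ X]eq_fun do rewrite /= EFinM.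
  by apply: integrableZl => //; exact: source_integrable.
- exact: attenuated_source_integrable.
move=> u; rewrite in_itv/= => /andP[su ut].
have u0 := le_trans s0 su; have /andP[f_ge0 _] := f_bounds _ u0.
rewrite ler_wpM2r//; apply: le_trans (expR_ge1Dx _).
have A0 : 0 <= A by have /andP[? ?] := a_bounds _ u0; lra.
rewrite lerD2l lerN2; apply: (@le_trans _ _ (A * (t - u))).
  by apply: depth_le => // w /(a_bounds w)/andP[].
by rewrite ler_wpM2l// lerD2l lerN2.
Qed.

Lemma decayed_source_integrable (t : R) :
  mu.-integrable `[0, t] (EFin \o (fun s => expR (- (t - s)) * f s)).
Proof.
apply: (bounded_integrable_segment _ B).
  apply: measurable_funM; last exact: measurable_on_segment.
  apply: (eq_measurable_fun (fun u : R => expR (u - t) : R)).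
    by move=> u _; rewrite opprB.
  by apply: measurableT_comp => //; exact: measurable_funB.
move=> u /andP[u0 ut]; have /andP[f0 fB] := f_bounds _ u0.
rewrite ger0_norm ?mulr_ge0 ?expR_ge0//; apply: le_trans fB.
by rewrite ler_piMl// -[leRHS]expR0 ler_expR oppr_le0 subr_ge0.
Qed.

Lemma duhamel_le (t : R) : 0 <= t -> 0 <= y0 -> (forall s, 0 <= s -> 1 <= a s) ->
  duhamel t <= y0 * expR (- t)
    + \int[mu]_(s in `[0, t]) (expR (- (t - s)) * f s).
Proof.
move=> t0 y_ge0 a1; apply: lerD.
  rewrite ler_wpM2l// ler_expR lerN2.
  by have := depth_ge _ _ _ (lexx 0) t0 a1; rewrite mul1r subr0.
apply: le_Rintegral => //=; first exact: attenuated_source_integrable.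
  exact: decayed_source_integrable.
move=> u; rewrite in_itv/= => /andP[u0 ut]; have /andP[f0 fB] := f_bounds _ u0.
rewrite ler_wpM2r// ler_expR lerN2.
by have := depth_ge _ _ _ u0 ut a1; rewrite mul1r.
Qed.

End Duhamel.

(** * Elementary real analysis *)

Section RealLemmas.
Context {R : realType}.
Local Notation mu := (@lebesgue_measure R).

(** Inversion is discontinuous at 0; powers of exponent - 1 on each half-line
    reduce its measurability to that of [powR]. *)
Lemma measurable_inv : measurable_fun [set: R] (@GRing.inv R).
Proof.
apply: (eq_measurable_fun
  (fun x : R => if 0 <= x then x `^ (-1) else - (- x) `^ (-1))).
  move=> x _; case: ifPn => [x0|]; first by rewrite powR_inv1.
  by rewrite -ltNge => x0; rewrite powR_inv1 ?oppr_ge0 ?ltW// invrN opprK.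
apply: measurable_fun_ifT; first exact: measurable_fun_ler.
  exact: measurable_powR.
have mN : measurable_fun [set: R] (fun x : R => - x) by exact: oppr_measurable.
have mP := measurableT_comp (measurable_powR (-1 : R)) mN.
exact: (measurable_funN mP).
Qed.

Lemma integral_exponential (c t : R) : 0 < c -> 0 <= t ->
  (\int[mu]_(s in `[0%R, t]) (c * expR (c * s))%:E = (expR (c * t) - 1)%:E)%E.
Proof.
move=> c0; rewrite le_eqVlt => /orP[/eqP<-|t0].
  by rewrite set_itv1 integral_set1 mulr0 expR0 subrr.
have dF (s : R) : is_derive s (1 : R) (fun s => expR (c * s)) (c * expR (c * s)).
  have -> : c * expR (c * s) = expR (c * s) *: (c *: (1 : R)).
    by rewrite /GRing.scale/= mulr1 mulrC.
  apply: is_derive1_comp.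
have cF : continuous (fun s : R => expR (c * s)).
  by move=> s; apply: differentiable_continuous; apply/derivable1_diffP; case: (dF s).
rewrite (@continuous_FTC2 _ _ (fun s => expR (c * s)))//.
- by rewrite mulr0 expR0 EFinB.
- apply: continuous_subspaceT => s; apply: cvgM; first exact: cvg_cst.
  exact: cF.
- split.
  + by move=> s _; case: (dF s).
  + exact/cvg_at_right_filter/cF.
  + exact/cvg_at_left_filter/cF.
- by move=> s _; rewrite derive1E; apply: derive_val.
Qed.

Lemma subdivision (t d : R) : 0 <= t -> 0 < d ->
  exists (n : nat) (h : R), [/\ 0 <= h, h <= d & t = n%:R * h].
Proof.
move=> t0 d0; pose n := Num.bound (t / d).
have td : t / d < n.+1%:R.
  apply: lt_le_trans (_ : n%:R <= _); last by rewrite ler_nat.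
  by have := archi_boundP (divr_ge0 t0 (ltW d0)).
exists n.+1, (t / n.+1%:R); split; first by rewrite divr_ge0.
  by rewrite ler_pdivrMr// mulrC -ler_pdivrMr// ltW.
by rewrite mulrC divfK.
Qed.

Lemma expR_ge_inv (x : R) : 0 <= x < 1 -> expR x <= (1 - x)^-1.
Proof.
move=> /andP[x0 x1]; rewrite -[leLHS]invrK -expRN lef_pV2 ?posrE ?expR_gt0 ?subr_gt0//.
exact: expR_ge1Dx.
Qed.

(** The right-hand side is the growth factor over a time step [h] of the value
    [z <= K] in [solution_gain_step], when a proportion [m] of the velocities
    is under control.  For m = 1 its derivative at h = 0 is r (1 - K), so that
    for [m] close to 1 and small [h] it dominates exp (lam h) for every
    lam < r (1 - K).  The room between [lam] and the mean [lam'] of [lam] and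
    r (1 - K) absorbs the exponential, the rest absorbs [m] and [h]. *)
Lemma growth_rate_of_small_steps (r K lam : R) : 0 < r -> 0 <= K <= 1 ->
  0 <= lam < r * (1 - K) ->
  exists d, [/\ 0 < d, (1 + r) ^+ 2 * d <= 1 &
    forall m h, 1 - d <= m -> 0 <= h <= d ->
      expR (lam * h) <=
        1 - h + h * (m * (1 - h) * ((1 + r) * (1 - (1 + r) * h) - r * K))].
Proof.
move=> r0 /andP[K0 K1] /andP[lam0 lamK].
pose lam' := (lam + r * (1 - K)) / 2.
have lam'0 : 0 < lam' by rewrite /lam'; lra.
have lamlam' : lam < lam' by rewrite /lam'; lra.
pose C := 2 * (1 + r) + (1 + r) ^+ 2.
have r10 : 0 < 1 + r by rewrite addr_gt0.
have C0 : 0 < C by rewrite /C ltr_wpDr ?sqr_ge0// mulr_gt0.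
(* d2 makes the Euler rate at least lam'; d3 makes
   1 + lam' h >= exp (lam h). *)
pose d1 := ((1 + r) ^+ 2)^-1.
pose d2 := (r * (1 - K) - lam') / C.
pose d3 := (lam' - lam) / (lam' * (lam + 1)).
have d1_gt0 : 0 < d1 by rewrite invr_gt0 exprn_gt0// addr_gt0.
have d2_gt0 : 0 < d2 by rewrite divr_gt0// /lam'; lra.
have l10 : 0 < lam' * (lam + 1) by rewrite mulr_gt0//; lra.
have d3_gt0 : 0 < d3 by rewrite divr_gt0// subr_gt0.
pose d := Num.min d1 (Num.min d2 d3).
have dd1 : d <= d1 by rewrite ge_min lexx.
have dd2 : d <= d2 by rewrite !ge_min lexx orbT.
have dd3 : d <= d3 by rewrite !ge_min lexx !orbT.
have r1d : (1 + r) ^+ 2 * d <= 1.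
  by rewrite mulrC -ler_pdivlMr ?mul1r// exprn_gt0// addr_gt0.
have Cd : C * d <= r * (1 - K) - lam' by rewrite mulrC -ler_pdivlMr.
have ld : lam' * (lam + 1) * d <= lam' - lam by rewrite mulrC -ler_pdivlMr.
have d0 : 0 < d by rewrite !lt_min d1_gt0 d2_gt0.
exists d; split=> // m h md /andP[h0 hd].
have d_le1 : d <= 1.
  apply: le_trans r1d; rewrite ler_peMl ?(ltW d0)// expr_ge1 ?lerDl//; lra.
set Q := (1 + r) * (1 - (1 + r) * h) - r * K.
have r1h : (1 + r) ^+ 2 * h <= (1 + r) ^+ 2 * d by rewrite ler_wpM2l// sqr_ge0.
have rK : r * K <= r by rewrite ler_piMr// ltW.
have rK0 : 0 <= r * K by rewrite mulr_ge0// ltW.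
have r2h : 0 <= (1 + r) ^+ 2 * h by rewrite mulr_ge0// sqr_ge0.
have QE : Q = 1 + r - (1 + r) ^+ 2 * h - r * K by rewrite /Q; ring.
have Q0 : 0 <= Q by lra.
have Q1 : Q <= 1 + r by lra.
have QL : 1 + r * (1 - K) - (1 + r) ^+ 2 * d <= Q by rewrite QE; lra.
have key : 1 + lam' <= m * (1 - h) * Q.
  apply: (@le_trans _ _ ((1 - 2 * d) * Q)).
    have dQ : d * Q <= d * (1 + r) by rewrite ler_wpM2l// ltW.
    have : C * d = 2 * (d * (1 + r)) + (1 + r) ^+ 2 * d by rewrite /C; ring.
    lra.
  rewrite ler_wpM2r//; apply: (@le_trans _ _ ((1 - d) * (1 - d))).
    have := sqr_ge0 d; rewrite expr2; lra.
  by apply: ler_pM; lra.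
apply: (@le_trans _ _ (1 + lam' * h)); last first.
  have : h * (1 + lam') <= h * (m * (1 - h) * Q) by rewrite ler_wpM2l.
  lra.
have lh : lam' * (lam + 1) * h <= lam' - lam.
  by apply: le_trans ld; rewrite ler_wpM2l// ltW.
have llh0 : 0 <= lam * h by rewrite mulr_ge0.
have lam'h : 0 <= lam' * h by rewrite mulr_ge0// ltW.
have lh1 : lam * h < 1.
  have [->|lam_neq0] := eqVneq lam 0; first by rewrite mul0r ltr01.
  have lam_gt0 : 0 < lam by rewrite lt0r lam_neq0.
  by rewrite -(ltr_pM2l lam'0) mulr1; lra.
apply: (le_trans (expR_ge_inv _ _)); first by rewrite llh0.
rewrite -[leLHS]mul1r ler_pdivrMr ?subr_gt0//.
have : 0 <= h * (lam' - lam - lam' * (lam + 1) * h) by rewrite mulr_ge0// subr_ge0.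
have : 0 <= lam' * h * h by rewrite mulr_ge0.
lra.
Qed.

(** In [density_invasion], with S = sqrt (q t), the exponents are quadratic in S with
    linear errors, and the distances cubic with quadratic errors. *)
Lemma lower_powers_dominated (e1 e2 C1 C2 : R) : 0 < e1 -> 0 < e2 ->
  exists2 S0, 1 <= S0 & forall S, S0 <= S ->
    C1 * (1 + S) <= e1 * S ^+ 2 /\ C2 * (1 + S ^+ 2) <= e2 * S ^+ 3.
Proof.
move=> e10 e20.
pose S0 := Num.max 1 (Num.max (2 * `|C1| / e1) (2 * `|C2| / e2)).
exists S0; first by rewrite le_max lexx.
move=> S S0S.
have S1 : 1 <= S by apply: le_trans S0S; rewrite le_max lexx.
have SC1 : 2 * `|C1| <= e1 * S.
  rewrite -ler_pdivrMl// mulrC (le_trans _ S0S)//.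
  by rewrite /S0 !le_max lexx orbT.
have SC2 : 2 * `|C2| <= e2 * S.
  rewrite -ler_pdivrMl// mulrC (le_trans _ S0S)//.
  by rewrite /S0 !le_max lexx !orbT.
have S_ge0 : 0 <= S by lra.
have S2 : 1 <= S ^+ 2 by rewrite expr_ge1.
split.
  apply: (@le_trans _ _ (`|C1| * (1 + S))); first by rewrite ler_wpM2r ?ler_norm// addr_ge0.
  have : 2 * `|C1| * S <= e1 * S * S by rewrite ler_wpM2r.
  have : `|C1| <= `|C1| * S by rewrite ler_peMr.
  by rewrite expr2; lra.
apply: (@le_trans _ _ (`|C2| * (1 + S ^+ 2))).
  by rewrite ler_wpM2r ?ler_norm// addr_ge0// sqr_ge0.
have : 2 * `|C2| * S ^+ 2 <= e2 * S * S ^+ 2 by rewrite ler_wpM2r// sqr_ge0.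
have : `|C2| <= `|C2| * S ^+ 2 by rewrite ler_peMr.
by rewrite (exprS S 2); lra.
Qed.

Lemma powR32 (x : R) : 0 <= x -> x `^ (3 / 2) = Num.sqrt x ^+ 3.
Proof.
move=> x0; rewrite mulrC powRrM powR12_sqrt//.
by rewrite powR_mulrn// sqrtr_ge0.
Qed.

End RealLemmas.

(** * The Maxwellian and Gaussian profiles *)

Section KineticEquation.
Context {R : realType} (r sigma : R) (hr : 0 < r) (hsigma : 0 < sigma).
Local Notation mu := (@lebesgue_measure R).
Local Notation M := (maxwellian sigma).
Local Notation positive_times := [set t : R | 0 <= t].

Lemma normal_peakE (s : R) : 0 < s -> normal_peak s = (s * Num.sqrt (2 * pi))^-1.
Proof.
move=> s0; rewrite /normal_peak -mulrnAr sqrtrM ?sqr_ge0// sqrtr_sqr gtr0_norm//.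
by rewrite (mulr_natl pi 2).
Qed.

Lemma maxwellianE : M = normal_pdf 0 sigma.
Proof.
rewrite normal_pdfE ?gt_eqF//; apply/funext => v.
rewrite /maxwellian normal_peakE// /normal_fun; congr (_ * expR _).
by rewrite subr0 mulNr (mulr_natl (sigma ^+ 2) 2).
Qed.

Lemma maxwellian_gt0 v : 0 < M v.
Proof.
by rewrite mulr_gt0 ?expR_gt0// invr_gt0 mulr_gt0// sqrtr_gt0 mulr_gt0// pi_gt0.
Qed.

Lemma maxwellian_ge0 v : 0 <= M v.
Proof. exact/ltW/maxwellian_gt0. Qed.

Lemma measurable_maxwellian : measurable_fun [set: R] M.
Proof. by rewrite maxwellianE; exact: measurable_normal_pdf. Qed.

Lemma integral_maxwellian : (\int[mu]_v (M v)%:E = 1)%E.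
Proof. by rewrite maxwellianE; exact: integral_normal_pdf. Qed.

Lemma integrable_maxwellian : mu.-integrable [set: R] (EFin \o M).
Proof. by rewrite maxwellianE; exact: integrable_normal_pdf. Qed.

Lemma maxwellian_decr u v : 0 <= u -> u <= v -> M v <= M u.
Proof.
move=> u0 uv; have s0 := ltW hsigma.
rewrite /maxwellian ler_wpM2l ?invr_ge0 ?mulr_ge0 ?sqrtr_ge0//.
rewrite ler_expR lerN2 ler_wpM2r ?invr_ge0 ?mulr_ge0 ?sqr_ge0//.
by rewrite ler_sqr// nnegrE ?(le_trans u0).
Qed.

(** Almost all the mass is carried by bounded velocities: the normal law is
    continuous along an increasing sequence of segments. *)
Lemma maxwellian_bulk d : 0 < d ->
  exists2 W, 0 < W & 1 - d <= \int[mu]_(v in `[- W, W]) M v.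
Proof.
move=> d0; pose F n := `[- (n%:R), n%:R]%classic : set R.
have mF n : measurable (F n) by exact: measurable_itv.
have FT : \bigcup_n F n = [set: R].
  apply/seteqP; split => // x _; exists (Num.bound x) => //.
  rewrite /F /= in_itv/= -ler_norml.
  by have := archi_boundP (normr_ge0 x); rewrite /Num.bound normr_id => /ltW.
have ndF : nondecreasing_seq F.
  move=> m n mn; apply/subsetPset => x; rewrite /F /= !in_itv/= => /andP[a b].
  have : m%:R <= n%:R :> R by rewrite ler_nat.
  by move=> ?; apply/andP; split; lra.
have := @nondecreasing_cvg_mu _ _ R (normal_prob (0:R) sigma) F mF.
rewrite FT => /(_ measurableT ndF).
rewrite [X in _ --> X](_ : _ = 1%:E); last exact: integral_normal_pdf.
move=> /fine_cvgP[_ /cvgrPdist_lt/(_ _ d0)[N _ NF]].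
have := NF N.+1 (leqnSn N) => /= Nd.
exists N.+1%:R => //.
rewrite /Rintegral maxwellianE.
move: Nd; rewrite ltr_norml => /andP[_].
rewrite /normal_prob /F /=; lra.
Qed.

Lemma maxwellian_tail u : 0 <= u -> M (u + 1) <= \int[mu]_(v in `[u, u + 1]) M v.
Proof.
move=> u0.
have fin : (mu (`[u, (u + 1)%R]%classic : set R) < +oo)%E.
  by rewrite lebesgue_measure_itv/=; case: ifP; rewrite -?EFinB ltry.
have -> : M (u + 1) = \int[mu]_(v in `[u, u + 1]) (cst (M (u + 1))) v.
  rewrite Rintegral_cst//= lebesgue_measure_itv/= lte_fin ltrDl ltr01.
  by rewrite -EFinD/= addrAC subrr add0r mulr1.
apply: le_Rintegral => //=.
- apply: measurable_bounded_integrable => //=.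
  exact: bounded_cst.
- by apply: integrableS integrable_maxwellian.
- move=> v; rewrite in_itv/= => /andP[uv vu].
  by apply: maxwellian_decr => //; apply: le_trans uv.
Qed.

(** The Gaussian of variance sigma^2 w^2 with its maximum normalised to 1
    instead of its mass: this normalisation is the one for which the convolution
    inequality below has constant 1. *)
Definition gaussian_profile (w x : R) : R :=
  expR (- (x ^+ 2 / (2 * sigma ^+ 2 * w ^+ 2))).

(** Convolving two Gaussians adds their variances, and for maximum-normalised
    profiles the result w / sqrt D times the profile of width sqrt D, with
    D = w^2 + tau^2, lies below the profile of width w + tau >= sqrt D.  Unlike
    sqrt D, the width w + tau is additive in the duration of the flight, which
    makes the bound stable under successive flights. *)
Lemma gaussian_profile_convolution (w tau x : R) : 0 < w -> 0 <= tau ->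
  (\int[mu]_v (M v * gaussian_profile w (x - v * tau))%:E
     <= (gaussian_profile (w + tau) x)%:E)%E.
Proof.
move=> w0 tau0.
pose D := w ^+ 2 + tau ^+ 2.
have D0 : 0 < D by rewrite ltr_pwDl ?exprn_gt0// sqr_ge0.
have sD0 : 0 < Num.sqrt D by rewrite sqrtr_gt0.
pose s := sigma * w / Num.sqrt D.
have s0 : 0 < s by rewrite divr_gt0// mulr_gt0.
have wD : w <= Num.sqrt D.
  by rewrite -(ger0_norm (ltW w0)) -sqrtr_sqr ler_wsqrtr// lerDl sqr_ge0.
have Dw : D <= (w + tau) ^+ 2.
  rewrite sqrrD /D addrAC lerDl mulrn_wge0// mulr_ge0//; exact: ltW.
have sD2 : Num.sqrt D ^+ 2 = D by rewrite sqr_sqrtr// ltW.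
(* Completing the square in v. *)
have E v : M v * gaussian_profile w (x - v * tau) =
    (s / sigma * expR (- (x ^+ 2 / (2 * sigma ^+ 2 * D)))) * normal_pdf (x * tau / D) s v.
  rewrite normal_pdfE ?gt_eqF// normal_peakE// /maxwellian /gaussian_profile /normal_fun.
  rewrite -[LHS]mulrA -expRD [RHS]mulrACA -expRD; congr (_ * expR _).
    field; by rewrite !gt_eqF//= sqrtr_gt0 mulr_gt0// pi_gt0.
  have -> : s ^+ 2 = sigma ^+ 2 * w ^+ 2 / D by rewrite /s !exprMn exprVn sD2.
  have wt : w ^+ 2 + tau ^+ 2 != 0 by rewrite gt_eqF.
  by rewrite /D; field; rewrite !gt_eqF//.
under eq_integral do rewrite E EFinM.
rewrite ge0_integralZl//=; last 3 first.
- by apply/measurable_EFinP; exact: measurable_normal_pdf.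
- by move=> v _; rewrite lee_fin normal_pdf_ge0.
- by rewrite lee_fin mulr_ge0 ?expR_ge0// divr_ge0// ltW.
rewrite integral_normal_pdf mule1 lee_fin.
rewrite (@le_trans _ _ (1 * expR (- (x ^+ 2 / (2 * sigma ^+ 2 * D)))))//.
  rewrite ler_wpM2r ?expR_ge0// ler_pdivrMr// mul1r /s ler_pdivrMr//.
  by rewrite ler_wpM2l// ltW.
rewrite mul1r ler_expR lerN2 ler_wpM2l ?sqr_ge0// lef_pV2 ?posrE.
- by rewrite ler_wpM2l// mulr_ge0// sqr_ge0.
- by rewrite !mulr_gt0// ?exprn_gt0// ltr_wpDr.
- by rewrite !mulr_gt0// exprn_gt0.
Qed.

Lemma gaussian_profile_ge0 w x : 0 <= gaussian_profile w x.
Proof. exact: expR_ge0. Qed.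

Lemma maxwellian_dilation (b x : R) :
  M (x / b) = (sigma * Num.sqrt (2 * pi))^-1 * gaussian_profile b x.
Proof.
rewrite /maxwellian /gaussian_profile; congr (_ * expR (- _)).
by rewrite exprMn exprVn -[LHS]mulrA -invfM (mulrC (b ^+ 2)).
Qed.

(** * The solution along its characteristics *)

Context (g0 : R -> R -> R) (g : R -> R -> R -> R).
Hypothesis g_sol : mild_solution r sigma g0 g.

Section Characteristics.

Let future : set (R * (R * R)) := [set p | 0 <= p.1].

Let measurable_future : measurable future.
Proof.
have -> : future = fst @^-1` positive_times by [].
rewrite -[X in measurable X]setTI; apply: measurable_fst => //.
exact: measurable_positive_times.
Qed.

(** The extension of [g] by 0 to negative times is measurable on the whole
    space, as Tonelli's theorem requires. *)
Let g_extended : R * (R * R) -> R := (fun p => g p.1 p.2.1 p.2.2) \_ future.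

Let measurable_g_extended : measurable_fun setT g_extended.
Proof.
have mg := @mild_measurable _ _ _ _ _ g_sol.
exact: ((measurable_restrictT _ measurable_future).1 mg).
Qed.

Let g_extendedE t x v : 0 <= t -> g_extended (t, (x, v)) = g t x v.
Proof. by move=> t0; rewrite /g_extended patchE mem_set. Qed.

Let g_extended_ge0 p : 0 <= g_extended p.
Proof.
rewrite /g_extended patchE; case: ifPn => // /set_mem p0.
by have /andP[] := mild_bounds g_sol p.2.1 p.2.2 p0.
Qed.

Lemma measurable_solution_section t x : 0 <= t -> measurable_fun setT (g t x).
Proof.
move=> t0; apply: (eq_measurable_fun (fun v : R => g_extended (t, (x, v)))).
  by move=> v _; rewrite g_extendedE.
by apply: measurableT_comp => //; apply: measurable_fun_pair.
Qed.

(** The density need not be continuous, even along a line: for instance, the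
    initial datum may be concentrated on characteristics that meet at one time.
    Its measurability along curves comes from Tonelli's theorem. *)
Lemma measurable_density_along (y : R -> R) : measurable_fun setT y ->
  measurable_fun positive_times (fun s => rho g s (y s)).
Proof.
move=> my.
pose h (p : R * R) := (g_extended (p.1, (y p.1, p.2)))%:E.
have mh : measurable_fun setT h.
  apply/measurable_EFinP; apply: measurableT_comp => //.
  apply: measurable_fun_pair => //; apply: measurable_fun_pair => //.
  exact: measurableT_comp.
have h0 p : (0 <= h p)%E by rewrite lee_fin.
apply: (eq_measurable_fun (fun s : R => fine (fubini_F mu h s))).
  move=> s /set_mem /= s0; rewrite /fubini_F /h /= /rho /Rintegral.
  by congr fine; apply: eq_integral => v _; rewrite g_extendedE.
apply: measurable_funTS.
apply: measurableT_comp; first exact: fine_measurable.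
exact: measurable_fun_fubini_tonelli_F.
Qed.

Lemma solution_integrable t x : 0 <= t -> mu.-integrable setT (EFin \o g t x).
Proof.
move=> t0; apply: (le_integrable _ _ _ integrable_maxwellian) => //.
  by apply/measurable_EFinP; exact: measurable_solution_section.
move=> v _ /=; rewrite lee_fin; have /andP[? ?] := mild_bounds g_sol x v t0.
by rewrite !ger0_norm// maxwellian_ge0.
Qed.

Lemma density_ge0 t x : 0 <= t -> 0 <= rho g t x.
Proof.
by move=> t0; apply: Rintegral_ge0 => v _; have /andP[] := mild_bounds g_sol x v t0.
Qed.

Lemma Rintegral_maxwellian : \int[mu]_v M v = 1.
Proof. by rewrite /Rintegral integral_maxwellian. Qed.

Lemma density_le1 t x : 0 <= t -> rho g t x <= 1.
Proof.
move=> t0; rewrite -Rintegral_maxwellian; apply: le_Rintegral => //.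
- exact: solution_integrable.
- exact: integrable_maxwellian.
- by move=> v _; have /andP[] := mild_bounds g_sol x v t0.
Qed.

Lemma density_ge (c lo hi t x : R) : 0 <= t ->
  (forall v, lo <= v <= hi -> c * M v <= g t x v) ->
  c * \int[mu]_(v in `[lo, hi]) M v <= rho g t x.
Proof.
move=> t0 cg.
have iM : mu.-integrable `[lo, hi] (EFin \o M).
  by apply: integrableS integrable_maxwellian.
have ig : mu.-integrable `[lo, hi] (EFin \o g t x).
  by apply: integrableS (solution_integrable t x t0).
apply: (@le_trans _ _ (\int[mu]_(v in `[lo, hi]) g t x v)).
  rewrite -RintegralZl//; apply: le_Rintegral => //=.
  by under [X in integrable _ _ X]eq_fun do rewrite /= EFinM; apply: integrableZl.
rewrite /rho /Rintegral fine_le//.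
- exact: integrable_fin_num.
- by apply: integrable_fin_num => //; exact: solution_integrable.
apply: ge0_subset_integral => //=.
- by apply/measurable_EFinP; exact: measurable_solution_section.
- by move=> v _; rewrite lee_fin; have /andP[] := mild_bounds g_sol x v t0.
Qed.

(** Absorption and source along the characteristic of velocity [v] issued from
    [x] at time 0.  Parametrising by the foot of the characteristic makes both
    independent of the final time. *)
Let a (x v s : R) := 1 + r * rho g s (x + v * s).
Let f (x v s : R) := (1 + r) * M v * rho g s (x + v * s).

Let rho_meas x v : measurable_fun positive_times (fun s => rho g s (x + v * s)).
Proof. by apply: measurable_density_along; apply: measurable_funD. Qed.

Let a_meas x v : measurable_fun positive_times (a x v).
Proof. by apply: measurable_funD => //; apply: measurable_funM. Qed.

Let f_meas x v : measurable_fun positive_times (f x v).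
Proof. exact: measurable_funM. Qed.

Let a_bounds x v s : 0 <= s -> 0 <= a x v s <= 1 + r.
Proof.
move=> s0; have := density_ge0 s (x + v * s) s0; have := density_le1 s (x + v * s) s0.
have r0 := ltW hr.
by move=> ? ?; rewrite /a addr_ge0 ?mulr_ge0//= lerD2l ler_piMr.
Qed.

Let f_bounds x v s : 0 <= s -> 0 <= f x v s <= (1 + r) * M v.
Proof.
move=> s0; have := density_ge0 s (x + v * s) s0; have := density_le1 s (x + v * s) s0.
have := maxwellian_ge0 v => ? ? ?.
have : 0 <= (1 + r) * M v by rewrite mulr_ge0// addr_ge0// ltW.
by move=> ?; rewrite /f mulr_ge0//= ler_piMr.
Qed.

Lemma solution_duhamel (x v t : R) : 0 <= t ->
  g t (x + v * t) v = duhamel (a x v) (f x v) (g0 x v) t.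
Proof.
move=> t0; have -> := mild_formula g_sol (x + v * t) v t0.
rewrite -[LHS]/(duhamel (absorption r g t (x + v * t) v)
  (fun s => (1 + r) * M v * rho g s (x + v * t - v * (t - s)))
  (g0 (x + v * t - v * t) v) t).
have -> : x + v * t - v * t = x by rewrite addrK.
have -> : absorption r g t (x + v * t) v = a x v.
  apply/funext => s; rewrite /absorption /a.
  by have -> : x + v * t - (t - s) * v = x + v * s by ring.
have -> // : (fun s => (1 + r) * M v * rho g s (x + v * t - v * (t - s))) = f x v.
apply/funext => s; rewrite /f.
by have -> : x + v * t - v * (t - s) = x + v * s by ring.
Qed.

(** Over a short step the equation only sees the density through its integral
    [p] along the path, in the loss r p as well as in the source. *)
Lemma solution_step (s h x v p : R) : 0 <= s -> 0 <= h ->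
  p = \int[mu]_(u in `[s, s + h]) rho g u (x + v * u) ->
  g s (x + v * s) v * (1 - (h + r * p))
    + (1 - (1 + r) * h) * ((1 + r) * M v * p) <= g (s + h) (x + v * (s + h)) v.
Proof.
move=> s0 h0 ->.
have ir : mu.-integrable `[s, s + h] (EFin \o (fun u => rho g u (x + v * u))).
  apply: (bounded_integrable_segment _ 1).
    exact: (measurable_on_segment _ _ _ (rho_meas x v)).
  move=> u /andP[su _]; have u0 := le_trans s0 su.
  by rewrite ger0_norm ?density_le1// density_ge0.
have sh : s <= s + h by rewrite lerDl.
have Eh : s + h - s = h by ring.
have := duhamel_step _ _ _ _ (g0 x v) (a_meas x v) (f_meas x v)
  (a_bounds x v) (f_bounds x v) s (s + h) s0 sh.
rewrite -!solution_duhamel ?addr_ge0//.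
have g_nonneg : 0 <= g s (x + v * s) v by have /andP[] := mild_bounds g_sol (x + v * s) v s0.
move=> /(_ g_nonneg).
rewrite /a /f RintegralZl// RintegralD//=; last 2 first.
- by apply: (bounded_integrable_segment _ `|1|).
- by under [X in integrable _ _ X]eq_fun do rewrite /= EFinM; apply: integrableZl.
by rewrite RintegralZl// Rintegral_segment_cst// Eh mul1r.
Qed.

(** Only the part 1 of the absorption rate 1 + r rho is kept, which makes the
    bound monotone in the density.  It is stated with extended-real integrals,
    ready for an exchange of the integrals in time and velocity. *)
Lemma solution_le (beta : R -> R) (t x v : R) : 0 <= t -> 0 <= g0 x v ->
  measurable_fun `[0, t] beta ->
  (forall s, 0 <= s <= t -> rho g s (x + v * s) <= beta s) ->
  ((g t (x + v * t) v)%:E <= (g0 x v * expR (- t))%:E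
    + \int[mu]_(s in `[0%R, t]) ((1 + r) * expR (- (t - s)) * (M v * beta s))%:E)%E.
Proof.
move=> t0 g00 mb rb; rewrite solution_duhamel//.
have a1 s : 0 <= s -> 1 <= a x v s.
  by move=> s0; rewrite lerDl mulr_ge0 ?(ltW hr)// density_ge0.
have r10 : 0 <= 1 + r by rewrite addr_ge0// ltW.
have fi := decayed_source_integrable _ _ (f_meas x v) (f_bounds x v) t.
have := duhamel_le _ _ _ _ (g0 x v) (a_meas x v) (f_meas x v)
  (a_bounds x v) (f_bounds x v) t t0 g00 a1.
rewrite -lee_fin [X in (_ <= X)%E]EFinD => /le_trans; apply; rewrite leeD2l//.
rewrite /Rintegral fineK; last exact: integrable_fin_num.
apply: ge0_le_integral => //=.
- move=> s; rewrite in_itv/= => /andP[s0 st].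
  by rewrite lee_fin mulr_ge0 ?expR_ge0//; have /andP[] := f_bounds x v s s0.
- by case/integrableP: fi.
- apply/measurable_EFinP; apply: measurable_funM; last exact: measurable_funM.
  apply: measurable_funM => //; apply: measurable_funTS.
  apply: (eq_measurable_fun (fun u : R => expR (u - t) : R)).
    by move=> u _; rewrite opprB.
  by apply: measurableT_comp => //; exact: measurable_funB.
move=> s; rewrite in_itv/= => /andP[s0 st]; rewrite lee_fin /f.
rewrite [leRHS](_ : _ = expR (- (t - s)) * ((1 + r) * M v * beta s)); last by ring.
rewrite ler_wpM2l ?expR_ge0// ler_wpM2l ?rb ?s0//.
by rewrite mulr_ge0// maxwellian_ge0.
Qed.

End Characteristics.

(** * Short time steps, flight and growth *)

Let M_gt0 v : 0 < M v. Proof. exact: maxwellian_gt0. Qed.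

Lemma solution_ge0 (t x v : R) : 0 <= t -> 0 <= g t x v.
Proof. by move=> t0; have /andP[] := mild_bounds g_sol x v t0. Qed.

Lemma solution_le_maxwellian (t x v : R) : 0 <= t -> g t x v <= M v.
Proof. by move=> t0; have /andP[] := mild_bounds g_sol x v t0. Qed.

Lemma density_path_bounds (s h x v c : R) : 0 <= s -> 0 <= h ->
  (forall u, s <= u <= s + h -> c <= rho g u (x + v * u)) ->
  c * h <= \int[mu]_(u in `[s, s + h]) rho g u (x + v * u) <= h.
Proof.
move=> s0 h0 cr.
have my : measurable_fun setT (fun u : R => x + v * u).
  by apply: measurable_funD.
have ir : mu.-integrable `[s, s + h] (EFin \o (fun u => rho g u (x + v * u))).
  apply: (bounded_integrable_segment _ 1).
    apply: measurable_on_segment => //.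
    exact: (measurable_density_along _ my).
  move=> u /andP[su _]; have u0 := le_trans s0 su.
  rewrite ger0_norm; first exact: density_le1.
  exact: density_ge0.
have sh : s <= s + h by rewrite lerDl.
have Eh : s + h - s = h by ring.
have icst k : mu.-integrable `[s, s + h] (EFin \o (fun=> k)).
  exact: (bounded_integrable_segment _ `|k|).
apply/andP; split.
  have := Rintegral_segment_cst c s (s + h) sh; rewrite Eh => <-.
  by apply: le_Rintegral => // u; rewrite /= in_itv/=; exact: cr.
have := Rintegral_segment_cst 1 s (s + h) sh; rewrite Eh mul1r => {2}<-.
apply: le_Rintegral => // u; rewrite /= in_itv/= => /andP[su _].
exact: (density_le1 _ _ (le_trans s0 su)).
Qed.

(** The monotonicity of the equation, over one time step.  In
    [solution_step] the coefficient of g at time [s] is nonnegative, so that g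
    may be replaced by z M; then the coefficient of the path integral p of the
    density is M ((1 + r) (1 - (1 + r) h) - r z).  It is nonnegative for
    z <= 1 and small h, so that p may be replaced by its lower bound c h.  In
    other words, the gain (1 + r) M rho exceeds the additional loss r rho g
    because g <= M. *)
Lemma solution_gain_step (s h x v z c : R) :
  0 <= s -> 0 <= h -> (1 + r) ^+ 2 * h <= 1 -> z <= 1 -> z * M v <= g s (x + v * s) v ->
  (forall u, s <= u <= s + h -> c <= rho g u (x + v * u)) ->
  (z * (1 - h) + c * h * ((1 + r) * (1 - (1 + r) * h) - r * z)) * M v
    <= g (s + h) (x + v * (s + h)) v.
Proof.
move=> s0 h0 rh z1 zg cr.
have /andP[cp ph] := density_path_bounds _ _ _ _ _ s0 h0 cr.
apply: le_trans (solution_step s h x v _ s0 h0 erefl).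
set p := Rintegral _ _ _ in cp ph *; set y := g s _ v in zg *.
have Mv0 := M_gt0 v.
have r0 := ltW hr.
have rp : r * p <= r * h by rewrite ler_wpM2l.
have r2 : (1 + r) * h <= (1 + r) ^+ 2 * h.
  by rewrite expr2 -mulrA ler_peMl ?mulr_ge0 ?addr_ge0// lerDl.
have rz : r * z <= r by rewrite ler_piMr.
have k0 : 0 <= 1 - (h + r * p) by lra.
have K0 : 0 <= (1 + r) * (1 - (1 + r) * h) - r * z.
  have -> : (1 + r) * (1 - (1 + r) * h) = 1 + r - (1 + r) ^+ 2 * h by ring.
  lra.
have A : z * M v * (1 - (h + r * p)) <= y * (1 - (h + r * p)) by rewrite ler_wpM2r.
have B : c * h * ((1 + r) * (1 - (1 + r) * h) - r * z) * M v <=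
   p * ((1 + r) * (1 - (1 + r) * h) - r * z) * M v.
  by rewrite ler_wpM2r ?(ltW Mv0)// ler_wpM2r.
lra.
Qed.

(** Where the density is positive the gain compensates the additional
    absorption, so that the solution decays at most like under absorption at rate 1. *)
Lemma solution_flight_step (s h x v : R) :
  0 <= s -> 0 <= h -> (1 + r) ^+ 2 * h <= 1 ->
  (1 - h) * g s (x + v * s) v <= g (s + h) (x + v * (s + h)) v.
Proof.
move=> s0 h0 rh; have Mv0 := M_gt0 v.
pose z := g s (x + v * s) v / M v.
have zE : z * M v = g s (x + v * s) v by rewrite divfK// gt_eqF.
have z1 : z <= 1 by rewrite ler_pdivrMr// mul1r solution_le_maxwellian.
have := solution_gain_step s h x v z 0 s0 h0 rh z1.
rewrite zE lexx !mul0r addr0 mulrAC zE mulrC; apply=> //.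
by move=> u /andP[su _]; exact: (density_ge0 _ _ (le_trans s0 su)).
Qed.

(** The rate 1 is replaced by 1 + eta in order to use steps of a fixed
    length, with 1 - h >= exp (- (1 + eta) h), instead of passing to the
    limit. *)
Lemma solution_flight (eta s t x v : R) : 0 < eta -> 0 <= s -> 0 <= t ->
  expR (- ((1 + eta) * t)) * g s (x + v * s) v <= g (s + t) (x + v * (s + t)) v.
Proof.
move=> eta0 s0 t0.
have eta1 : 0 < 1 + eta by rewrite addr_gt0.
pose d := Num.min ((1 + r) ^+ 2)^-1 (eta / (1 + eta)).
have r1 : 0 < (1 + r) ^+ 2 by rewrite exprn_gt0// addr_gt0.
have d0 : 0 < d by rewrite lt_min invr_gt0 r1 divr_gt0.
have [n [h [h0 hd ->]]] := subdivision t d t0 d0.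
have rh : (1 + r) ^+ 2 * h <= 1.
  by rewrite mulrC -ler_pdivlMr// mul1r (le_trans hd)// ge_min lexx.
have eh : (1 + eta) * h <= eta.
  by rewrite mulrC -ler_pdivlMr// (le_trans hd)// ge_min lexx orbT.
have h1 : 0 < 1 - h by rewrite subr_gt0 -(ltr_pM2l eta1) mulr1; lra.
have e1 : expR (- ((1 + eta) * h)) <= 1 - h.
  have eh0 : 0 <= (1 + eta) * h by rewrite mulr_ge0// ltW.
  rewrite expRN invf_ple ?posrE ?expR_gt0//.
  apply: le_trans (expR_ge1Dx _).
  rewrite -[leLHS]mul1r ler_pdivrMr//.
  have : 0 <= h * (eta - (1 + eta) * h) by rewrite mulr_ge0// subr_ge0.
  lra.
elim: n => [|n IH]; first by rewrite mul0r mulr0 oppr0 expR0 mul1r addr0.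
have sn : 0 <= s + n%:R * h by rewrite addr_ge0// mulr_ge0.
have := solution_flight_step _ h x v sn h0 rh.
have -> : s + n%:R * h + h = s + n.+1%:R * h by rewrite -natr1; ring.
apply: le_trans.
have -> : - ((1 + eta) * (n.+1%:R * h)) = - ((1 + eta) * h) + - ((1 + eta) * (n%:R * h)).
  by rewrite -natr1; ring.
rewrite expRD -mulrA; apply: ler_pM => //; rewrite ?expR_ge0//.
by rewrite mulr_ge0 ?expR_ge0// solution_ge0.
Qed.

Section Growth.
Context (W K lam d : R).
Hypothesis K1 : K <= 1.
Hypothesis d_bound : (1 + r) ^+ 2 * d <= 1.
Hypothesis d_gt0 : 0 < d.
Local Notation m := (\int[mu]_(v in `[- W, W]) M v).
Hypothesis rate : forall h, 0 <= h <= d -> expR (lam * h) <=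
  1 - h + h * (m * (1 - h) * ((1 + r) * (1 - (1 + r) * h) - r * K)).

Let m_ge0 : 0 <= m.
Proof. by apply: Rintegral_ge0 => v _; exact/ltW/M_gt0. Qed.

(** For |v| <= W and 0 <= u - s <= h the backward characteristic from a point
    x < X - W (u - s) is in x < X at time s.  Flight from time s gives
    g >= (1 - h) z M at time u for these velocities, hence the density
    is at least (1 - h) z m there, and [solution_gain_step] applies with this
    value of c. *)
Lemma solution_growth_step (s h X z : R) : 0 <= s -> 0 <= h <= d -> 0 <= z <= K ->
  (forall x v, x < X -> - W <= v <= W -> z * M v <= g s x v) ->
  forall x v, x < X - W * h -> - W <= v <= W ->
    z * expR (lam * h) * M v <= g (s + h) x v.
Proof.
move=> s0 hd /andP[z0 zK] zg x v xX vW.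
have /andP[h0 hd'] := hd.
have rh : (1 + r) ^+ 2 * h <= 1.
  by apply: le_trans d_bound; rewrite ler_wpM2l// sqr_ge0.
have r1h : h <= (1 + r) ^+ 2 * h.
  by rewrite ler_peMl// expr_ge1// ?lerDl ?addr_ge0// ltW.
have h1 : 0 <= 1 - h by lra.
have z1 : z <= 1 by apply: le_trans K1.
have xE : x = x - v * (s + h) + v * (s + h) by rewrite subrK.
pose c := (1 - h) * z * m.
have cr u : s <= u <= s + h -> c <= rho g u (x - v * (s + h) + v * u).
  move=> /andP[su ush]; apply: density_ge.
    exact: le_trans su.
  move=> w wW; set y := x - v * (s + h) + v * u.
  have us0 : 0 <= u - s by rewrite subr_ge0.
  have rus : (1 + r) ^+ 2 * (u - s) <= 1.
    by apply: le_trans rh; rewrite ler_wpM2l ?sqr_ge0// lerBlDl.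
  have := solution_flight_step s (u - s) (y - w * u) w s0 us0 rus.
  have -> : s + (u - s) = u by ring.
  rewrite subrK; apply: le_trans; rewrite -mulrA; apply: ler_pM => //.
  - by rewrite mulr_ge0// ltW.
  - by rewrite lerD2l lerN2 lerBlDl.
  apply: zg => //; move: vW wW => /andP[v1 v2] /andP[w1 w2].
  have : v * (s + h - u) >= - W * (s + h - u) by rewrite ler_wpM2r// subr_ge0.
  have : w * (u - s) >= - W * (u - s) by rewrite ler_wpM2r.
  rewrite /y; lra.
have zgs : z * M v <= g s (x - v * (s + h) + v * s) v.
  apply: zg => //; move: vW => /andP[v1 v2].
  have : v * h >= - W * h by rewrite ler_wpM2r.
  lra.
have := solution_gain_step s h _ v z c s0 h0 rh z1 zgs cr; rewrite subrK.
apply: le_trans; rewrite ler_wpM2r ?(ltW (M_gt0 v))//.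
apply: (@le_trans _ _ (z * (1 - h + h * (m * (1 - h) * ((1 + r) * (1 - (1 + r) * h) - r * K))))).
  by rewrite ler_wpM2l// rate.
have A : 0 <= z * h * (m * (1 - h)) by rewrite !mulr_ge0.
have B : z * h * (m * (1 - h)) * (r * z) <= z * h * (m * (1 - h)) * (r * K).
  by rewrite ler_wpM2l// ler_wpM2l// ltW.
rewrite /c; lra.
Qed.

(** The bound K on the final value ensures that the intermediate values remain
    in the range in which the rate [lam] is valid. *)
Lemma solution_growth (s t X z : R) : 0 <= s -> 0 <= t -> 0 <= lam -> 0 <= z ->
  z * expR (lam * t) <= K ->
  (forall x v, x < X -> - W <= v <= W -> z * M v <= g s x v) ->
  forall x v, x < X - W * t -> - W <= v <= W ->
    z * expR (lam * t) * M v <= g (s + t) x v.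
Proof.
move=> s0 t0 lam0 z0; have [n [h [h0 hd ->]]] := subdivision t d t0 d_gt0.
move=> zK zg; elim: n zK => [|n IH] zK.
  by rewrite mul0r !mulr0 expR0 mulr1 subr0 addr0.
have sn : 0 <= s + n%:R * h by rewrite addr_ge0// mulr_ge0.
have nle : z * expR (lam * (n%:R * h)) <= z * expR (lam * (n.+1%:R * h)).
  by rewrite ler_wpM2l// ler_expR ler_wpM2l// ler_wpM2r// ler_nat.
have znK := le_trans nle zK.
have hh : 0 <= h <= d by rewrite h0.
have zz : 0 <= z * expR (lam * (n%:R * h)) <= K by rewrite mulr_ge0 ?expR_ge0.
have := solution_growth_step _ h _ _ sn hh zz (IH znK).
have -> : s + n%:R * h + h = s + n.+1%:R * h by rewrite -natr1; ring.
have -> : X - W * (n%:R * h) - W * h = X - W * (n.+1%:R * h) by rewrite -natr1; ring.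
rewrite -mulrA -expRD.
by have -> : lam * (n%:R * h) + lam * h = lam * (n.+1%:R * h) by rewrite -natr1; ring.
Qed.

End Growth.
(** * Propagation to the right *)

Section Invasion.
Context (gamma xL : R).
Hypothesis gamma01 : 0 < gamma < 1.
Hypothesis g0_ge : forall x v : R, gamma * M v * \1_`]-oo, xL[ x <= g0 x v.

Let gamma_gt0 : 0 < gamma. Proof. by case/andP: gamma01. Qed.

(** The time integrals of the mild formula are over a single point at t = 0. *)
Lemma solution_initial x v : g 0 x v = g0 x v.
Proof.
have E := solution_duhamel x v 0 (lexx 0).
rewrite mulr0 addr0 in E; rewrite E /duhamel set_itv1 !Rintegral_set1.
by rewrite oppr0 expR0 mulr1 addr0.
Qed.

(** Particles of the half-line x < xL with velocity in [u0, u0 + 1] reach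
    every point of x < xL + u0 tau after time tau.  The unit width of the
    velocity window makes its mass at least M (u0 + 1). *)
Lemma density_after_flight (eta tau h u0 : R) : 0 < eta -> 0 <= tau -> 0 <= u0 ->
  forall u x, tau <= u <= tau + h -> x < xL + u0 * tau ->
    expR (- ((1 + eta) * (tau + h))) * gamma * M (u0 + 1) <= rho g u x.
Proof.
move=> eta0 tau0 u00 u x /andP[tu uh] xu.
have u_ge0 := le_trans tau0 tu.
apply: le_trans (density_ge
  (expR (- ((1 + eta) * (tau + h))) * gamma) u0 (u0 + 1) _ _ u_ge0 _).
  by rewrite ler_wpM2l ?maxwellian_tail// mulr_ge0 ?expR_ge0// ltW.
move=> v /andP[uv _].
have := solution_flight eta 0 u (x - v * u) v eta0 (lexx 0) u_ge0.
rewrite mulr0 addr0 add0r subrK solution_initial; apply: le_trans.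
rewrite -mulrA; apply: ler_pM; rewrite ?expR_ge0//.
- by rewrite mulr_ge0 ?(ltW gamma_gt0)// ltW.
- by rewrite ler_expR lerN2 ler_wpM2l// addr_ge0// ltW.
apply: le_trans (g0_ge _ _); rewrite indicE mem_set ?mulr1//=.
rewrite in_itv/=.
have : u0 * tau <= v * u by apply: ler_pM.
lra.
Qed.

(** Growth needs a lower bound on g for all velocities in [- W, W], whereas
    flight only provides one on the density.  One time step, started from the
    trivial bound z = 0, redistributes the density over all velocities. *)
Lemma solution_seeding (eta tau h u0 W : R) : 0 < eta -> 0 <= tau -> 0 <= u0 ->
  0 <= h -> (1 + r) ^+ 2 * h <= 1 ->
  forall x v, x < xL + u0 * tau - W * h -> - W <= v <= W ->
    (expR (- ((1 + eta) * (tau + h))) * gamma * M (u0 + 1)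
      * (h * ((1 + r) * (1 - (1 + r) * h)))) * M v <= g (tau + h) x v.
Proof.
move=> eta0 tau0 u00 h0 rh x v xX /andP[v1 v2].
have := solution_gain_step tau h (x - v * (tau + h)) v 0
  (expR (- ((1 + eta) * (tau + h))) * gamma * M (u0 + 1)) tau0 h0 rh ler01.
rewrite !mul0r add0r mulr0 subr0 subrK -!mulrA; apply.
  by have /andP[] := mild_bounds g_sol (x - v * (tau + h) + v * tau) v tau0.
move=> u /andP[tu uh]; rewrite mulrA.
apply: (density_after_flight eta tau h u0) => //; first by rewrite tu.
have : - W * (tau + h - u) <= v * (tau + h - u) by rewrite ler_wpM2r// subr_ge0.
have : W * (tau + h - u) <= W * h.
  by rewrite ler_wpM2l; lra.
lra.
Qed.

(** The time t is split into a flight of duration tau = q t, one step of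
    length d, a growth of duration TA from the tiny value zA to K1, and a growth
    of bounded duration TB from K1 to K2.  The cap K1 = 1/16 is small enough for
    the growth rate lam1 = 7/8 r to be allowed, and this rate still beats the
    cost of the flight: lam1 (1 - q) = 7/4 q, against 9/8 q + q / 2 for a flight
    with absorption rate 9/8.  The cap K2 and the proportion m of controlled
    velocities are at least 1 - gamma / 2, so that their product is at least
    1 - gamma. *)
Lemma density_invasion (eps : R) : 0 < eps -> exists t0, forall t, t0 <= t ->
  forall x, x <= (1 - eps) * sigma * (r / (r + 2) * t) `^ (3 / 2) ->
    1 - gamma <= rho g t x.
Proof.
move=> eps0; have r0 : 0 < r by exact: hr.
have [gamma0 gamma1] := andP gamma01.
have sigma0 : 0 < sigma by exact: hsigma.
pose q := r / (r + 2).
have r20 : 0 < r + 2 by rewrite addr_gt0.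
have q0 : 0 < q by rewrite divr_gt0.
have rq : r * (1 - q) = 2 * q by rewrite /q; field; rewrite gt_eqF.
have q1 : 0 < 1 - q by rewrite -(pmulr_rgt0 _ hr) rq mulr_gt0.
pose K1 : R := 1 / 16; pose lam1 : R := 7 / 8 * r.
have K1_01 : 0 <= K1 <= 1 by rewrite /K1; apply/andP; split; lra.
have lam1P : 0 <= lam1 < r * (1 - K1) by rewrite /lam1 /K1; apply/andP; split; lra.
have [d1 [d10 rd1 rate1]] := growth_rate_of_small_steps r K1 lam1 hr K1_01 lam1P.
pose K2 : R := 1 - gamma / 2; pose lam2 : R := r * gamma / 4.
have K2_01 : 0 <= K2 <= 1 by rewrite /K2; apply/andP; split; lra.
have rg : 0 < r * gamma by rewrite mulr_gt0.
have lam2P : 0 <= lam2 < r * (1 - K2) by rewrite /lam2 /K2; apply/andP; split; lra.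
have [d2 [d20 rd2 rate2]] := growth_rate_of_small_steps r K2 lam2 hr K2_01 lam2P.
pose d := Num.min d1 d2.
have d0 : 0 < d by rewrite lt_min d10.
have dd1 : d <= d1 by rewrite ge_min lexx.
have dd2 : d <= d2 by rewrite ge_min lexx orbT.
have rd : (1 + r) ^+ 2 * d <= 1.
  by apply: le_trans rd1; rewrite ler_wpM2l// sqr_ge0.
have dl0 : 0 < Num.min d (gamma / 2) by rewrite lt_min d0 divr_gt0.
have [W W0 bulk] := maxwellian_bulk _ dl0.
set m := Rintegral _ _ _ in bulk.
have md : 1 - d <= m by apply: le_trans bulk; rewrite lerD2l lerN2 ge_min lexx.
have mg : 1 - gamma / 2 <= m.
  by apply: le_trans bulk; rewrite lerD2l lerN2 ge_min lexx orbT.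
have {}rate1 h : 0 <= h <= d -> _ :=
  fun hd => rate1 m h (le_trans (lerB (lexx 1) dd1) md)
    (introT andP (conj (proj1 (andP hd)) (le_trans (proj2 (andP hd)) dd1))).
have {}rate2 h : 0 <= h <= d -> _ :=
  fun hd => rate2 m h (le_trans (lerB (lexx 1) dd2) md)
    (introT andP (conj (proj1 (andP hd)) (le_trans (proj2 (andP hd)) dd2))).
have K1_gt0 : 0 < K1 by rewrite /K1; lra.
have lam2_gt0 : 0 < lam2 by rewrite /lam2 divr_gt0.
have K12 : 1 <= K2 / K1 by rewrite ler_pdivlMr// mul1r /K1 /K2; lra.
pose TB := ln (K2 / K1) / lam2.
have TB0 : 0 <= TB by rewrite divr_ge0 ?ln_ge0// ltW.
(* C0 gathers the prefactors of the value reached after the flight and the step,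
   C1 the terms of order at most S in the exponents, and C2 the distance lost
   during the growth together with the offset xL. *)
pose C0 := gamma * (sigma * Num.sqrt (2 * pi))^-1 * (d * ((1 + r) * (1 - (1 + r) * d))).
have C0_gt0 : 0 < C0.
  rewrite /C0 !mulr_gt0// ?invr_gt0 ?mulr_gt0// ?sqrtr_gt0 ?mulr_gt0 ?pi_gt0//.
    by rewrite addr_gt0.
  rewrite subr_gt0; apply: lt_le_trans rd; rewrite ltr_pM2r// expr2 ltr_pMr ?addr_gt0//.
  by rewrite ltrDl.
pose C1 := sigma^-1 + `|9 / 8 * d + (2 * sigma ^+ 2)^-1 - ln C0 + lam1 * (d + TB)|.
pose C2 := W / q + `|xL| + 1.
have e1_gt0 : (0 : R) < 1 / 8 by lra.
have es0 : 0 < eps * sigma by rewrite mulr_gt0.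
have [S0 S01 large] := lower_powers_dominated (1 / 8) (eps * sigma) C1 C2 e1_gt0 es0.
exists (Num.max (S0 ^+ 2 / q) ((d + TB) / (1 - q))) => t.
rewrite ge_max => /andP[tS tTB] x xle.
have tTB' : d + TB <= (1 - q) * t by rewrite mulrC -ler_pdivrMr.
have qt : S0 ^+ 2 <= q * t by rewrite mulrC -ler_pdivrMr.
pose S := Num.sqrt (q * t).
have qt0 : 0 <= q * t by apply: le_trans qt; rewrite sqr_ge0.
have S2 : S ^+ 2 = q * t by rewrite sqr_sqrtr.
have S_ge0 : 0 <= S by exact: sqrtr_ge0.
have S0S : S0 <= S.
  by rewrite -(@ler_pXn2r _ 2)// ?nnegrE ?S2//; lra.
have [E1 E2] := large S S0S.
rewrite powR32// -/q -/S in xle.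
pose tau := q * t; pose u0 := sigma * S.
have u00 : 0 <= u0 by rewrite mulr_ge0// ltW.
pose TA := (1 - q) * t - d - TB.
have TA0 : 0 <= TA by rewrite /TA; lra.
have eta0 : (0 : R) < 1 / 8 by lra.
have seed := solution_seeding (1 / 8) tau d u0 W eta0 qt0 u00 (ltW d0) rd.
pose kappa := expR (- ((1 + 1 / 8) * (tau + d))) * gamma * M (u0 + 1)
  * (d * ((1 + r) * (1 - (1 + r) * d))).
pose zA := K1 * expR (- (lam1 * TA)).
have zA0 : 0 <= zA by rewrite mulr_ge0 ?expR_ge0// ltW.
(* zA is chosen to reach K1 exactly after the time TA; it must lie below the
   value kappa that the flight provides. *)
have zA_kappa : zA <= kappa.
  apply: (@le_trans _ _ (expR (- (lam1 * TA)))).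
    by rewrite ler_piMl ?expR_ge0//; case/andP: K1_01.
  have -> : kappa = expR (ln C0 - (1 + 1 / 8) * (tau + d)
      - (u0 + 1) ^+ 2 / (2 * sigma ^+ 2)).
    rewrite !expRD lnK ?posrE// /kappa /maxwellian /C0; ring.
  rewrite ler_expR /TA.
  have -> : (u0 + 1) ^+ 2 / (2 * sigma ^+ 2) =
      S ^+ 2 / 2 + S / sigma + (2 * sigma ^+ 2)^-1.
    by rewrite /u0; field; rewrite gt_eqF.
  have -> : lam1 * ((1 - q) * t - d - TB) = 7 / 4 * S ^+ 2 - lam1 * (d + TB).
    have : r * (1 - q) * t = 2 * (q * t) by rewrite rq mulrA.
    by rewrite S2 /lam1; lra.
  rewrite /tau -S2; move: E1; rewrite /C1.
  set Y := (_ + lam1 * _); have := ler_norm Y => YY.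
  have : 0 <= `|Y| * S by rewrite mulr_ge0.
  have : 0 <= sigma^-1 by rewrite invr_ge0 ltW.
  by rewrite /Y in YY *; lra.
have growA : forall x v, x < xL + u0 * tau - W * d - W * TA -> - W <= v <= W ->
    K1 * M v <= g (tau + d + TA) x v.
  have KE : zA * expR (lam1 * TA) = K1 by rewrite /zA -mulrA -expRD addNr expR0 mulr1.
  move=> y v yX vW.
  have := solution_growth W K1 lam1 d _ rd d0 rate1
    (tau + d) TA (xL + u0 * tau - W * d) zA.
  rewrite KE; apply=> //.
  - by case/andP: K1_01.
  - by rewrite addr_ge0// ltW.
  - by case/andP: lam1P.
  - move=> y' v' yX' vW'; apply: le_trans (seed _ _ yX' vW').
    by rewrite ler_wpM2r// ltW.
have -> : t = tau + d + TA + TB by rewrite /tau /TA; ring.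
have growB : forall v, - W <= v <= W -> K2 * M v <= g (tau + d + TA + TB) x v.
  have KE : K1 * expR (lam2 * TB) = K2.
    have -> : lam2 * TB = ln (K2 / K1) by rewrite /TB mulrCA divff ?mulr1// gt_eqF.
    rewrite lnK; first by rewrite mulrCA divff ?mulr1// gt_eqF.
    by rewrite posrE (lt_le_trans ltr01).
  move=> v vW.
  have := solution_growth W K2 lam2 d _ rd d0 rate2
    (tau + d + TA) TB (xL + u0 * tau - W * d - W * TA) K1.
  rewrite KE; apply=> //.
  - by case/andP: K2_01.
  - by rewrite addr_ge0// addr_ge0// ltW.
  - by case/andP: lam2P.
  - by case/andP: K1_01.
  - apply: (le_lt_trans xle).
    have -> : xL + u0 * tau - W * d - W * TA - W * TB = xL + sigma * S ^+ 3 - W * ((1 - q) * t).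
      by rewrite /u0 /tau -S2 /TA; ring.
    have Wt : W * ((1 - q) * t) <= W / q * S ^+ 2.
      have -> : W / q * S ^+ 2 = W * t by rewrite S2; field; rewrite gt_eqF.
      rewrite ler_wpM2l ?(ltW W0)//.
      have : 0 <= q * t by []. lra.
    have Wq0 : 0 <= W / q by rewrite divr_ge0 ?ltW.
    have S20 : 0 <= S ^+ 2 by rewrite sqr_ge0.
    have xS : 0 <= `|xL| * S ^+ 2 by rewrite mulr_ge0.
    have := ler_norm (- xL); rewrite normrN => xN.
    rewrite /C2 in E2; lra.
apply: le_trans (density_ge K2 (- W) W _ _ _ growB); last first.
  by rewrite /= addr_ge0// addr_ge0// addr_ge0// ltW.
rewrite -/m; apply: (@le_trans _ _ (K2 * (1 - gamma / 2))).
  have : 0 <= gamma * gamma by rewrite mulr_ge0// ltW.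
  by rewrite /K2; lra.
by rewrite ler_wpM2l//; case/andP: K2_01.
Qed.

End Invasion.

(** * Gaussian upper bound *)

Section UpperBound.
Hypothesis g0_ge0 : forall x v, 0 <= g0 x v.

(** The integral inequality for the density: integrate [solution_le] in
    velocity and exchange the integrals by Tonelli's theorem. *)
Lemma density_le (t x : R) (G0 : R -> R) (N : R * R -> R) : 0 <= t ->
  measurable_fun setT G0 -> measurable_fun setT N ->
  (forall p, 0 <= N p) ->
  (forall v, g0 (x - v * t) v <= G0 v) ->
  (forall v s, 0 <= s <= t -> rho g s (x - v * (t - s)) <= N (v, s)) ->
  ((rho g t x)%:E <= \int[mu]_v (expR (- t) * G0 v)%:E +
    \int[mu]_(s in `[0%R, t]) (((1 + r) * expR (- (t - s)))%:E *
      \int[mu]_v (M v * N (v, s))%:E))%E.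
Proof.
move=> t0 mG0 mN N0 g0G rN.
have r10 : 0 <= 1 + r by rewrite addr_ge0// ltW.
have M0 v : 0 <= M v by exact: maxwellian_ge0.
have mM := measurable_maxwellian.
have mdecay : measurable_fun setT (fun s : R => (1 + r) * expR (- (t - s))).
  apply: measurable_funM => //.
  apply: (eq_measurable_fun (fun u : R => expR (u - t) : R)).
    by move=> u _; rewrite opprB.
  by apply: measurableT_comp => //; exact: measurable_funB.
have G00 v : 0 <= G0 v by exact: le_trans (g0_ge0 _ _) (g0G v).
pose h (v s : R) := (1 + r) * expR (- (t - s)) * (M v * N (v, s)).
have h0 v s : 0 <= h v s by apply: mulr_ge0; apply: mulr_ge0; rewrite ?expR_ge0.
have mh : measurable_fun setT (fun p : R * R => h p.1 p.2).
  apply: measurable_funM; first exact: (measurableT_comp mdecay measurable_snd).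
  apply: measurable_funM; first exact: (measurableT_comp mM measurable_fst).
  by apply: (eq_measurable_fun N) => // -[].
(* The indicator turns the time integral into one over the whole line. *)
pose H (p : R * R) : \bar R := (h p.1 p.2 * \1_`[0, t] p.2)%:E.
have mH : measurable_fun setT H.
  apply/measurable_EFinP; apply: measurable_funM => //.
  by apply: measurableT_comp => //; exact: measurable_indic.
have H0 p : (0 <= H p)%E by rewrite lee_fin mulr_ge0// indicE.
have HE v : (\int[mu]_(s in `[0%R, t]) (h v s)%:E = \int[mu]_s H (v, s))%E.
  rewrite integral_mkcond; apply: eq_integral => s _.
  by rewrite patchE /H/= indicE; case: ifPn => _; rewrite ?mulr1 ?mulr0.
rewrite /rho /Rintegral fineK; last first.
  by apply: integrable_fin_num => //; exact: (solution_integrable).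
have mG : measurable_fun setT (fun v : R => (expR (- t) * G0 v)%:E).
  by apply/measurable_EFinP; exact: measurable_funM.
have mF : measurable_fun setT (fun v => \int[mu]_s H (v, s))%E.
  by have := @measurable_fun_fubini_tonelli_F _ _ _ _ R mu H; exact.
apply: (@le_trans _ _ (\int[mu]_v ((expR (- t) * G0 v)%:E + \int[mu]_s H (v, s)))%E).
  apply: ge0_le_integral => //.
  - by move=> v _; rewrite lee_fin; have /andP[] := mild_bounds g_sol x v t0.
  - by apply/measurable_EFinP; exact: (measurable_solution_section).
  - exact: emeasurable_funD.
  move=> v _; rewrite -HE.
  have mb : measurable_fun `[0, t] (fun s : R => N (v, s)).
    by apply: measurable_funTS; exact: measurableT_comp.
  have rb s : 0 <= s <= t -> rho g s (x - v * t + v * s) <= N (v, s).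
    move=> /(rN v s); suff -> : x - v * (t - s) = x - v * t + v * s by [].
    by ring.
  have := solution_le _ t (x - v * t) v t0 (g0_ge0 _ _) mb rb.
  rewrite subrK => /le_trans; apply; rewrite leeD2r// lee_fin mulrC.
  by rewrite ler_wpM2l ?expR_ge0.
rewrite ge0_integralD//; last 2 first.
- by move=> v _; rewrite lee_fin mulr_ge0 ?expR_ge0.
- by move=> v _; exact: integral_ge0.
rewrite leeD2l// fubini_tonelli// [leRHS]integral_mkcond.
rewrite le_eqVlt; apply/orP; left; apply/eqP; apply: eq_integral => s _.
rewrite patchE /H/= indicE; case: ifPn => _.
  under eq_integral do rewrite mulr1 /h EFinM.
  rewrite ge0_integralZl//.
  - apply/measurable_EFinP; apply: measurable_funM => //.
    exact: measurableT_comp.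
  - by move=> v _; rewrite lee_fin; apply: mulr_ge0.
  - by rewrite lee_fin mulr_ge0 ?expR_ge0.
by under eq_integral do rewrite mulr0; rewrite integral0.
Qed.

Lemma measurable_gaussian_profile (w : R * R -> R) (y : R * R -> R) :
  measurable_fun setT w -> measurable_fun setT y ->
  measurable_fun setT (fun p => gaussian_profile (w p) (y p)).
Proof.
move=> mw my; apply: measurableT_comp => //; apply: measurable_funN.
apply: measurable_funM; first exact: measurable_funX.
apply: (measurableT_comp (measurable_inv)).
by apply: measurable_funM => //; exact: measurable_funX.
Qed.

Context (A b : R).
Hypothesis b_gt0 : 0 < b.
Hypothesis A_ge0 : 0 <= A.
Hypothesis g0_le : forall x v, g0 x v <= A * gaussian_profile b x * M v.

(** Inserting the majorant into [density_le], the Gaussian part reproduces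
    itself: after a flight of duration t - s the profile of width b + s is below
    that of width b + t, and the time integral of (1 + r) e^(- (t - s)) e^(r s)
    is e^(r t) - e^(- t), whose last term makes room for the initial datum.
    The exponent 1 + 2 r of the error is chosen so that the same integral
    yields the factor (1 + r) / (2 + 2 r) = 1/2. *)
Lemma majorant_contraction (theta : R) : 0 <= theta ->
  (forall s y, 0 <= s -> rho g s y <=
     A * expR (r * s) * gaussian_profile (b + s) y + theta * expR ((1 + 2 * r) * s)) ->
  forall t x, 0 <= t -> rho g t x <=
     A * expR (r * t) * gaussian_profile (b + t) x + theta / 2 * expR ((1 + 2 * r) * t).
Proof.
move=> theta0 rho_le t x t0.
have M0 v : 0 <= M v by exact: maxwellian_ge0.
have mM := measurable_maxwellian.
have P0 w y : 0 <= gaussian_profile w y by exact: gaussian_profile_ge0.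
set P := gaussian_profile (b + t) x.
pose N (p : R * R) := A * expR (r * p.2) * gaussian_profile (b + p.2) (x - p.1 * (t - p.2))
  + theta * expR ((1 + 2 * r) * p.2).
have N0 p : 0 <= N p.
  by apply: addr_ge0; apply: mulr_ge0; rewrite ?expR_ge0 ?mulr_ge0 ?expR_ge0.
have mexp (k : R) : measurable_fun setT (fun p : R * R => expR (k * p.2)).
  by apply: measurableT_comp => //; exact: measurable_funM.
have mN : measurable_fun setT N.
  apply: measurable_funD; last by apply: measurable_funM => //; exact: mexp.
  apply: measurable_funM; first by apply: measurable_funM => //; exact: mexp.
  apply: measurable_gaussian_profile; first exact: measurable_funD.
  apply: measurable_funB => //; apply: measurable_funM => //.
  exact: measurable_funB.
have mprof (w : R) (k : R) : measurable_fun setT (fun v : R => gaussian_profile w (x - v * k)).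
  have := measurable_gaussian_profile (fun=> w) (fun p : R * R => x - p.1 * k).
  have m1 : measurable_fun setT (fun p : R * R => x - p.1 * k).
    by apply: measurable_funB => //; exact: measurable_funM.
  move=> /(_ (measurable_cst _) m1) mp.
  exact: (measurable_fun_pair1 (0 : R) mp).
have conv (w tau : R) : 0 < w -> 0 <= tau ->
    (\int[mu]_v (M v * gaussian_profile w (x - v * tau))%:E <= (gaussian_profile (w + tau) x)%:E)%E.
  exact: gaussian_profile_convolution.
pose G0 (v : R) := A * (M v * gaussian_profile b (x - v * t)).
have mG0 : measurable_fun setT G0.
  by apply: measurable_funM => //; exact: measurable_funM.
have g0G v : g0 (x - v * t) v <= G0 v.
  by apply: le_trans (g0_le _ _) _; rewrite /G0 -mulrA (mulrC (M v)).
have rN v s : 0 <= s <= t -> rho g s (x - v * (t - s)) <= N (v, s).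
  by move=> /andP[s0 _]; exact: rho_le.
have := density_le t x G0 N t0 mG0 mN N0 g0G rN.
have initial : (\int[mu]_v (expR (- t) * G0 v)%:E <= (expR (- t) * A * P)%:E)%E.
  under eq_integral do rewrite /G0 mulrA EFinM.
  rewrite ge0_integralZl//.
  - by rewrite [leRHS]EFinM lee_wpmul2l ?conv// lee_fin mulr_ge0 ?expR_ge0.
  - by apply/measurable_EFinP; apply: measurable_funM; [exact: mM|exact: mprof].
  - by move=> v _; rewrite lee_fin; apply: mulr_ge0.
  - by rewrite lee_fin mulr_ge0 ?expR_ge0.
have scattering s : 0 <= s <= t ->
    (\int[mu]_v (M v * N (v, s))%:E
      <= (A * expR (r * s) * P + theta * expR ((1 + 2 * r) * s))%:E)%E.
  move=> /andP[s0 st].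
  under eq_integral => v _.
    rewrite (_ : M v * _ = A * expR (r * s) * (M v * gaussian_profile (b + s) (x - v * (t - s)))
      + theta * expR ((1 + 2 * r) * s) * M v); last by rewrite /N/=; ring.
    rewrite EFinD; over.
  have mMP : measurable_fun setT (fun v : R => M v * gaussian_profile (b + s) (x - v * (t - s))).
    by apply: measurable_funM => //; exact: mprof.
  have Aer : 0 <= A * expR (r * s) by rewrite mulr_ge0 ?expR_ge0.
  have the : 0 <= theta * expR ((1 + 2 * r) * s) by rewrite mulr_ge0 ?expR_ge0.
  have MP0 v : 0 <= M v * gaussian_profile (b + s) (x - v * (t - s)) by apply: mulr_ge0.
  rewrite ge0_integralD//; last 4 first.
  - by move=> v _; rewrite lee_fin; apply: mulr_ge0.
  - by apply/measurable_EFinP; exact: measurable_funM.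
  - by move=> v _; rewrite lee_fin; apply: mulr_ge0.
  - by apply/measurable_EFinP; exact: measurable_funM.
  rewrite EFinD; apply: leeD.
    under eq_integral do rewrite EFinM.
    rewrite ge0_integralZl//.
    + rewrite [leRHS]EFinM lee_wpmul2l//.
      have bs : 0 < b + s by rewrite ltr_wpDr.
      have ts : 0 <= t - s by rewrite subr_ge0.
      apply: le_trans (conv _ _ bs ts) _.
      by have -> : b + s + (t - s) = b + t by ring.
    + exact/measurable_EFinP.
    + by move=> v _; rewrite lee_fin.
  under eq_integral do rewrite EFinM.
  rewrite ge0_integralZl//.
  - by rewrite integral_maxwellian// mule1.
  - exact/measurable_EFinP.
  - by move=> v _; rewrite lee_fin.
pose c := 1 + r.
have c0 : 0 < c by rewrite addr_gt0.
have c20 : 0 < 2 * c by rewrite mulr_gt0.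
have AP0 : 0 <= A * P by apply: mulr_ge0 => //; exact: P0.
have collision : (\int[mu]_(s in `[0%R, t]) (((1 + r) * expR (- (t - s)))%:E *
      \int[mu]_v (M v * N (v, s))%:E) <=
    (expR (- t) * (A * P * (expR (c * t) - 1) + theta / 2 * (expR (2 * c * t) - 1)))%:E)%E.
  pose h1 (s : R) := c * expR (c * s).
  pose h2 (s : R) := 2 * c * expR (2 * c * s).
  have mh (k : R) : measurable_fun setT (fun s : R => k * expR (k * s)).
    by apply: measurable_funM => //; apply: measurableT_comp => //; exact: measurable_funM.
  have h10 s : 0 <= h1 s by rewrite mulr_ge0 ?expR_ge0// ltW.
  have h20 s : 0 <= h2 s by rewrite mulr_ge0 ?expR_ge0// ltW.
  have mh1 : measurable_fun `[0, t] h1 by apply: measurable_funTS; exact: mh.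
  have mh2 : measurable_fun `[0, t] h2 by apply: measurable_funTS; exact: mh.
  have k1 : 0 <= expR (- t) * (A * P) by rewrite mulr_ge0 ?expR_ge0.
  have k2 : 0 <= expR (- t) * (theta / 2) by rewrite mulr_ge0 ?expR_ge0// divr_ge0.
  have mG : measurable_fun setT (fun s => \int[mu]_v (M v * N (v, s))%:E)%E.
    pose H (p : R * R) := (M p.1 * N p)%:E.
    have mH : measurable_fun setT H.
      apply/measurable_EFinP; apply: measurable_funM => //.
      exact: (measurableT_comp mM measurable_fst).
    have H0 p : (0 <= H p)%E by rewrite lee_fin; apply: mulr_ge0.
    by have := @measurable_fun_fubini_tonelli_G _ _ _ _ R mu H; exact.
  apply: (@le_trans _ _ (\int[mu]_(s in `[0%R, t])
     ((expR (- t) * (A * P) * h1 s)%:E + (expR (- t) * (theta / 2) * h2 s)%:E))%E).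
    apply: ge0_le_integral => //.
    - move=> s _; apply: mule_ge0.
        by rewrite lee_fin mulr_ge0 ?expR_ge0// ltW.
      by apply: integral_ge0 => v _; rewrite lee_fin; apply: mulr_ge0.
    - apply: emeasurable_funM; last exact: measurable_funTS.
      apply/measurable_EFinP; apply: measurable_funTS; apply: measurable_funM => //.
      apply: (eq_measurable_fun (fun u : R => expR (u - t) : R)).
        by move=> u _; rewrite opprB.
      by apply: measurableT_comp => //; exact: measurable_funB.
    - by apply: emeasurable_funD; apply/measurable_EFinP; exact: measurable_funM.
    move=> s; rewrite /= in_itv/= => st.
    apply: (@le_trans _ _ (((1 + r) * expR (- (t - s)))%:E *
       (A * expR (r * s) * P + theta * expR ((1 + 2 * r) * s))%:E)%E).
      by rewrite lee_wpmul2l ?scattering// lee_fin mulr_ge0 ?expR_ge0// ltW.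
    rewrite -EFinM -EFinD lee_fin /h1 /h2 /c.
    have -> : expR (- (t - s)) = expR (- t) * expR s by rewrite -expRD; congr expR; ring.
    have -> : (1 + r) * s = s + r * s by ring.
    have -> : 2 * (1 + r) * s = s + (1 + 2 * r) * s by ring.
    by rewrite !expRD; lra.
  rewrite ge0_integralD//; last 4 first.
  - by move=> s _; rewrite lee_fin mulr_ge0.
  - by apply/measurable_EFinP; exact: measurable_funM.
  - by move=> s _; rewrite lee_fin mulr_ge0.
  - by apply/measurable_EFinP; exact: measurable_funM.
  have I1 := integral_exponential c t c0 t0.
  have I2 := integral_exponential (2 * c) t c20 t0.
  under eq_integral do rewrite EFinM.
  rewrite ge0_integralZl//; last 2 first.
  - exact/measurable_EFinP.
  - by move=> s _; rewrite lee_fin.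
  rewrite I1.
  under eq_integral do rewrite EFinM.
  rewrite ge0_integralZl//; last 2 first.
  - exact/measurable_EFinP.
  - by move=> s _; rewrite lee_fin.
  by rewrite I2 -!EFinM -EFinD lee_fin; lra.
move=> /le_trans/(_ (leeD initial collision)); rewrite -EFinD lee_fin => /le_trans; apply.
have E1 : expR (r * t) = expR (- t) * expR (c * t).
  by rewrite -expRD /c; congr expR; ring.
have E2 : expR ((1 + 2 * r) * t) = expR (- t) * expR (2 * c * t).
  by rewrite -expRD /c; congr expR; ring.
rewrite E1 E2.
have : 0 <= theta * expR (- t) by rewrite mulr_ge0 ?expR_ge0.
by lra.
Qed.

(** Starting from rho <= 1 <= e^((1 + 2 r) t), the error is halved at will. *)
Lemma density_gaussian_bound (t x : R) : 0 <= t ->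
  rho g t x <= A * expR (r * t) * gaussian_profile (b + t) x.
Proof.
move=> t0.
have iter n : forall s y, 0 <= s -> rho g s y <=
    A * expR (r * s) * gaussian_profile (b + s) y + 2^-1 ^+ n * expR ((1 + 2 * r) * s).
  elim: n => [|n IH] s y s0.
    apply: (le_trans (density_le1 s y s0)).
    rewrite expr0 mul1r -[leLHS]add0r; apply: lerD.
      by rewrite mulr_ge0 ?gaussian_profile_ge0// mulr_ge0 ?expR_ge0.
    by rewrite -[leLHS]expR0 ler_expR mulr_ge0// addr_ge0// mulr_ge0// ltW.
  rewrite exprSr; exact: majorant_contraction.
apply/ler_addgt0Pr => e e0.
set E := expR ((1 + 2 * r) * t).
have E0 : 0 < E by exact: expR_gt0.
pose n := Num.bound (E / e).
apply: (le_trans (iter n t x t0)); rewrite lerD2l -/E exprVn mulrC.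
rewrite ler_pdivrMr ?exprn_gt0// -ler_pdivrMl// mulrC.
apply: (@le_trans _ _ n%:R); first exact/ltW/archi_boundP/ltW/divr_gt0.
by rewrite -natrX ler_nat ltnW// ltn_expl.
Qed.

(** For t >= 2 b / eps the width satisfies b + t <= (1 + eps / 2) t, and
    (1 + eps) / (1 + eps / 2) = 1 + kappa with kappa = eps / (2 + eps).  Hence
    the Gaussian exponent exceeds (1 + kappa)^2 r t >= (1 + kappa) r t, against
    a growth exponent r t. *)
Lemma gaussian_bound_decay (eps : R) : 0 < eps -> exists2 k, 0 < k &
  \forall t \near +oo, forall x,
    (1 + eps) * sigma * Num.sqrt (2 * r) * t `^ (3 / 2) <= `|x| ->
    A * expR (r * t) * gaussian_profile (b + t) x <= A * expR (- (k * t)).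
Proof.
move=> eps0.
pose kappa := eps / (2 + eps).
have kappa0 : 0 < kappa by rewrite divr_gt0// addr_gt0.
exists (kappa * r); first by rewrite mulr_gt0.
exists (2 * b / eps); split; first exact: num_real.
move=> t tb x.
have t0 : 0 < t by apply: le_lt_trans tb; rewrite divr_ge0 ?mulr_ge0 ?(ltW b_gt0) ?(ltW eps0).
have bt : 2 * b <= eps * t by rewrite -ler_pdivrMl// mulrC ltW.
have bt0 : 0 < b + t by rewrite addr_gt0.
have hs := hsigma; have hr' := hr.
have st : t `^ (3 / 2) ^+ 2 = t ^+ 3.
  by rewrite -powR_mulrn ?powR_ge0// -powRrM divfK ?pnatr_eq0// powR_mulrn// ltW.
have sr : Num.sqrt (2 * r) ^+ 2 = 2 * r by rewrite sqr_sqrtr// mulr_ge0// ltW.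
move=> xt.
have x2 : (1 + eps) ^+ 2 * sigma ^+ 2 * (2 * r) * t ^+ 3 <= x ^+ 2.
  rewrite -(real_normK (num_real x)) -st -sr -!exprMn ler_pXn2r ?nnegrE//.
  by rewrite !mulr_ge0 ?sqrtr_ge0 ?powR_ge0 ?(ltW hs)// addr_ge0// ltW.
rewrite -mulrA -expRD ler_wpM2l// ler_expR.
have main : (1 + kappa) * r * t <= x ^+ 2 / (2 * sigma ^+ 2 * (b + t) ^+ 2).
  have D0 : 0 < 2 * sigma ^+ 2 * (b + t) ^+ 2 by rewrite !mulr_gt0// exprn_gt0.
  rewrite ler_pdivlMr//; apply: le_trans x2.
  have bt2 : (1 + kappa) * (b + t) <= (1 + eps) * t.
    rewrite -(ler_pM2r (_ : 0 < (2 + eps))); last by lra.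
    have -> : (1 + kappa) * (b + t) * (2 + eps) = (1 + eps) * (2 * b + 2 * t).
      by rewrite /kappa; field; lra.
    rewrite -mulrA ler_wpM2l; [lra|lra|lra].
  have bt3 : (1 + kappa) * (b + t) ^+ 2 <= ((1 + eps) * t) ^+ 2.
    apply: (@le_trans _ _ (((1 + kappa) * (b + t)) ^+ 2)).
      rewrite exprMn ler_wpM2r ?sqr_ge0// expr2 ler_peMl; lra.
    rewrite ler_pXn2r// nnegrE mulr_ge0//; lra.
  have -> : (1 + kappa) * r * t * (2 * sigma ^+ 2 * (b + t) ^+ 2) =
     (r * t * (2 * sigma ^+ 2)) * ((1 + kappa) * (b + t) ^+ 2) by ring.
  have -> : (1 + eps) ^+ 2 * sigma ^+ 2 * (2 * r) * t ^+ 3 =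
     (r * t * (2 * sigma ^+ 2)) * ((1 + eps) * t) ^+ 2 by ring.
  rewrite ler_wpM2l// !mulr_ge0// ?sqr_ge0// ltW//.
lra.
Qed.

End UpperBound.

End KineticEquation.

(** * Propagation at the scale of t^(3/2) *)

Theorem theorem1p11 (R : realType) (r sigma : R) (hr : 0 < r)
    (hsigma : 0 < sigma)
    (g0 : R -> R -> R)
    (g0_meas : measurable_fun [set: R * R] (fun p : R * R => g0 p.1 p.2))
    (g0_bounds : forall x v : R, 0 <= g0 x v <= maxwellian sigma v)
    (g : R -> R -> R -> R) (g_sol : mild_solution r sigma g0 g) :
  ((exists a b : R, [/\ 1 <= b, b <= a &
       forall x v : R,
         g0 x v <= b^-1 * maxwellian sigma (x / b) * maxwellian sigma v
                     * expR (r * a)]) ->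
    forall epsilon : R, 0 < epsilon ->
      ereal_sup [set (rho g t x)%:E | x in
          [set x : R | (1 + epsilon) * sigma * Num.sqrt (2 * r) * t `^ (3 / 2)
                         <= `|x|]]
        @[t --> +oo] --> 0%:E)
  /\
  (forall gamma xL : R, 0 < gamma < 1 ->
    (forall x v : R,
       gamma * maxwellian sigma v * \1_`]-oo, xL[ x <= g0 x v) ->
    forall epsilon : R, 0 < epsilon ->
      ((1 - gamma)%:E <=
        limf_einf (fun t : R =>
          ereal_inf [set (rho g t x)%:E | x in
            [set x : R | (x <= (1 - epsilon) * sigma
                                * (r / (r + 2) * t) `^ (3 / 2))%R]])
          (pinfty_nbhs R))%E).
Proof.
split.
  move=> [a [b [b1 ba g0_le]]] eps eps0.
  have b0 : 0 < b by exact: lt_le_trans ltr01 b1.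
  have g0_ge0 x v : 0 <= g0 x v by case/andP: (g0_bounds x v).
  pose A := b^-1 * (sigma * Num.sqrt (2 * pi))^-1 * expR (r * a).
  have A0 : 0 <= A.
    by rewrite mulr_ge0 ?expR_ge0// -invfM invr_ge0 !mulr_ge0 ?sqrtr_ge0// ltW.
  have g0_profile x v : g0 x v <= A * gaussian_profile sigma b x * maxwellian sigma v.
    apply: (le_trans (g0_le x v)); rewrite maxwellian_dilation le_eqVlt.
    by apply/orP; left; apply/eqP; rewrite /A; ring.
  have rho_le t x t0 := density_gaussian_bound _ _ hr hsigma _ _ g_sol g0_ge0
    A b b0 A0 g0_profile t x t0.
  have [k k0 decay] := gaussian_bound_decay _ _ hr hsigma A b b0 A0 eps eps0.
  apply: (@squeeze_cvge _ _ _ _ (cst 0%E) _ (fun t => (A * expR (- (k * t)))%:E)).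
  - near=> t.
    have t0 : 0 <= t by near: t; apply: nbhs_pinfty_ge; exact: num_real.
    have decay_t : forall x, (1 + eps) * sigma * Num.sqrt (2 * r) * t `^ (3 / 2) <= `|x| ->
        A * expR (r * t) * gaussian_profile sigma (b + t) x <= A * expR (- (k * t)).
      by near: t; exact: decay.
    apply/andP; split.
      pose x := (1 + eps) * sigma * Num.sqrt (2 * r) * t `^ (3 / 2).
      apply: (@le_trans _ _ (rho g t x)%:E).
        by rewrite lee_fin; exact: (density_ge0 _ _ _ _ g_sol).
      by apply: ereal_sup_ubound; exists x => //=; exact: ler_norm.
    apply: ge_ereal_sup => _ [x /= xt <-]; rewrite lee_fin.
    exact: le_trans (rho_le t x t0) (decay_t x xt).
  - exact: cvg_cst.
  - apply: cvg_EFin; first by near=> t.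
    rewrite -(mulr0 A); apply: cvgM; first exact: cvg_cst.
    apply/cvgrPdist_le => e e0; near=> t.
    rewrite sub0r normrN ger0_norm ?expR_ge0// expRN invf_ple ?posrE ?expR_gt0//.
    apply: le_trans (expR_ge1Dx _).
    have : e^-1 / k <= t by near: t; apply: nbhs_pinfty_ge; exact: num_real.
    by rewrite ler_pdivrMr// mulrC; lra.
move=> gamma xL gamma01 g0_ge eps eps0.
have [t0 rho_ge] := density_invasion _ _ hr hsigma _ _ g_sol gamma xL gamma01 g0_ge eps eps0.
rewrite limf_einfE.
pose f (t : R) := ereal_inf [set (rho g t x)%:E | x in
  [set x : R | x <= (1 - eps) * sigma * (r / (r + 2) * t) `^ (3 / 2)]].
apply: (@le_trans _ _ (ereal_inf (f @` [set t | t0 <= t]))); last first.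
  apply: ereal_sup_ubound; exists [set t | t0 <= t] => //.
  by apply: nbhs_pinfty_ge; exact: num_real.
apply: le_ereal_inf_tmp => _ [t /= tt <-]; apply: le_ereal_inf_tmp => _ [x /= xt <-].
by rewrite lee_fin rho_ge.
Unshelve. all: by end_near.
Qed.
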